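(* Suppose $G$ is the Ferrers graph associated to a sequence of integers $\lambda_1>\lambda_2>\cdots>\lambda_m>0$ (with $m\ge 1$). Then $$\operatorname{depth}_S G=m+\min_{1\le j\le m}\{\lambda_1-\lambda_j-j+1\}$$ and $$\operatorname{depth}_E G=m+\min_{1\le j\le m}\{\lambda_1-\lambda_j-j\}.$$
   Context: Let $\mathbf{k}$ be an algebraically closed field of characteristic zero. Graphs are finite and simple. The Ferrers graph associated to $\lambda_1>\lambda_2>\cdots>\lambda_m>0$ is the bipartite graph on vertex set $\{v_1,\dots,v_m\}\sqcup\{w_1,\dots,w_{\lambda_1}\}$ with edge set $\{\{v_i,w_j\}\mid 1\le i\le m,\ 1\le j\le \lambda_i\}$. For a graph $G$ with vertex set $\{u_1,\dots,u_n\}$, let $E=\bigwedge_{\mathbf k}\langle e_1,\dots,e_n\rangle$ be the exterior algebra over $\mathbf{k}$ in $n$ variables, with degree-one part $E_1$, and $S=\mathbf{k}[x_1,\dots,x_n]$ the polynomial ring. The edge ideals are $I_E(G)=(e_ae_b \mid \{u_a,u_b\}\text{ is an edge of }G)\subseteq E$ and $I_S(G)=(x_ax_b\mid \{u_a,u_b\}\text{ is an edge of }G)\subseteq S$. For a graded $E$-module $M$, an element $\ell\in E_1$ is $M$-regular if $\{y\in M\mid \ell y=0\}=\ell M$. A sequence $\ell_1,\dots,\ell_r\in E_1$ is an $M$-regular sequence if $\ell_i$ is regular on $M/(\ell_1,\dots,\ell_{i-1})M$ for all $i\le r$; $\operatorname{depth}_E M$ is the maximum length of an $M$-regular sequence.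 Write $\operatorname{depth}_E G=\operatorname{depth}_E E/I_E(G)$, and $\operatorname{depth}_S G$ for the usual depth of $S/I_S(G)$ over $S$. *)

(* Defs.v *)
From HB Require Import structures.
From mathcomp Require Import all_boot all_order all_algebra.
From mathcomp Require Import mpoly ring.

Set Implicit Arguments.
Unset Strict Implicit.
Unset Printing Implicit Defensive.

Import Order.TTheory GRing.Theory Num.Theory.
Local Open Scope ring_scope.

(** An element of the exterior algebra on [e_0, ..., e_(n-1)] is given by its
    coordinates in the basis [e_A := e_a1 ... e_ar], for [A = {a1 < ... < ar}].
    One has [e_B * e_C = (-1) ^+ inversions B C *: e_(B :|: C)] if [B] and [C]
    are disjoint, and [e_B * e_C = 0] otherwise. *)
Definition exterior (k : comNzRingType) (n : nat) : Type :=
  {ffun {set 'I_n} -> k}.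

Definition inversions (n : nat) (B C : {set 'I_n}) : nat :=
  #|[set p in setX B C | (p.2 < p.1)%N]|.

Section ExteriorRing.
Variables (k : comNzRingType) (n : nat).
Implicit Types (A B C D X : {set 'I_n}) (f g h : exterior k n).

HB.instance Definition _ := Choice.on (exterior k n).
HB.instance Definition _ := GRing.Lmodule.copy (exterior k n)
  {ffun {set 'I_n} -> k^o}.

Definition ext_one : exterior k n := [ffun A : {set 'I_n} => (A == set0)%:R].

Definition ext_mul f g : exterior k n :=
  [ffun A : {set 'I_n} => \sum_(B : {set 'I_n} | B \subset A)
     (-1) ^+ inversions B (A :\: B) * f B * g (A :\: B)].

Lemma inversionsDl A B D : B \subset A ->
  inversions A D = (inversions B D + inversions (A :\: B) D)%N.
Proof.
move=> /subsetP sBA; rewrite /inversions -(cardsID (setX B setT)).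
congr (_ + _)%N; apply: eq_card => -[a b]; rewrite !inE /= ?andbT.
  by case: (boolP (a \in B)) => [/sBA -> | _]; rewrite ?andbT ?andbF.
by case: (a \in B); rewrite ?andbF ?andbT.
Qed.

Lemma inversionsDr A B D : B \subset A ->
  inversions D A = (inversions D B + inversions D (A :\: B))%N.
Proof.
move=> /subsetP sBA; rewrite /inversions -(cardsID (setX setT B)).
congr (_ + _)%N; apply: eq_card => -[a b]; rewrite !inE /=.
  by case: (boolP (b \in B)) => [/sBA -> | _]; rewrite ?andbT ?andbF.
by case: (b \in B); rewrite /= ?andbF ?andbT.
Qed.

Lemma inversions0l A : inversions set0 A = 0%N.
Proof. by apply: eq_card0 => -[a b]; rewrite !inE. Qed.

Lemma inversions0r A : inversions A set0 = 0%N.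
Proof. by apply: eq_card0 => -[a b]; rewrite !inE andbF. Qed.

Lemma ext_mulA : associative ext_mul.
Proof.
move=> f g h; apply/ffunP=> A; rewrite !ffunE.
under eq_bigr => B _ do rewrite ffunE mulr_sumr.
under [RHS]eq_bigr => X _ do rewrite ffunE mulr_sumr mulr_suml.
rewrite [RHS](exchange_big_dep (fun B : {set 'I_n} => B \subset A)) /=; last first.
  by move=> X B sXA sBX; apply: subset_trans sBX sXA.
apply: eq_bigr => B sBA.
rewrite [RHS](reindex_onto (fun C => B :|: C) (fun X => X :\: B)) /=; last first.
  by move=> X /andP[_ sBX]; rewrite setUC setDE setUIl setUC (setUC (~: B))
    setUCr setIT; apply/setUidPr.
have eqP C : (C \subset A :\: B) =
    (B :|: C \subset A) && (B \subset B :|: C) && ((B :|: C) :\: B == C).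
  rewrite subsetD subUset sBA subsetUl andbT setDUl setDv set0U.
  by rewrite (sameP eqP setDidPl).
rewrite (eq_bigl _ _ eqP) [LHS]big_seq_cond [RHS]big_seq_cond.
apply: eq_bigr => C /andP[_]; rewrite -eqP => sC.
have /andP[_ dCB] : (C \subset A) && [disjoint C & B] by rewrite -subsetD.
have eC : (B :|: C) :\: B = C.
  by rewrite setDUl setDv set0U; apply/setDidPl.
rewrite eC -setDDl.
rewrite (inversionsDr B sC) (@inversionsDl (B :|: C) B) ?subsetUl // eC !exprD.
move: (_ ^+ _) (_ ^+ _) (_ ^+ _) => a b c.
ring.
Qed.

Lemma ext_mul1 : left_id ext_one ext_mul.
Proof.
move=> f; apply/ffunP=> A; rewrite ffunE (bigD1 set0) ?sub0set //=.
rewrite big1 ?addr0 => [|B /andP[_ /negPf nB]]; last first.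
  by rewrite ffunE nB mulr0 mul0r.
by rewrite ffunE eqxx inversions0l expr0 !mul1r setD0.
Qed.

Lemma ext_mulr1 : right_id ext_one ext_mul.
Proof.
move=> f; apply/ffunP=> A; rewrite ffunE (bigD1 A) //=.
rewrite big1 ?addr0 => [|B /andP[sBA nB]]; last first.
  rewrite ffunE setD_eq0 [A \subset B]negbTE ?mulr0 //.
  by apply: contraNN nB => sAB; rewrite eqEsubset sBA.
by rewrite ffunE setDv eqxx inversions0r expr0 mul1r mulr1.
Qed.

Lemma ext_mulDl : left_distributive ext_mul +%R.
Proof.
move=> f g h; apply/ffunP=> A; rewrite !ffunE -big_split /=.
by apply: eq_bigr => B _; rewrite ffunE mulrDr mulrDl.
Qed.

Lemma ext_mulDr : right_distributive ext_mul +%R.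
Proof.
move=> f g h; apply/ffunP=> A; rewrite !ffunE -big_split /=.
by apply: eq_bigr => B _; rewrite ffunE mulrDr.
Qed.

Lemma ext_one_neq0 : ext_one != 0.
Proof.
by apply/eqP=> /ffunP/(_ set0)/eqP; rewrite !ffunE eqxx oner_eq0.
Qed.

HB.instance Definition _ := GRing.Zmodule_isNzRing.Build (exterior k n)
  ext_mulA ext_mul1 ext_mulr1 ext_mulDl ext_mulDr ext_one_neq0.

Lemma ext_scaleAl (a : k) f g : a *: (f * g) = (a *: f) * g.
Proof.
apply/ffunP=> A; rewrite !ffunE scaler_sumr; apply: eq_bigr => B _.
by rewrite ffunE /GRing.scale /= !mulrA [a * _]mulrC.
Qed.

HB.instance Definition _ :=
  GRing.Lmodule_isLalgebra.Build k (exterior k n) ext_scaleAl.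

Lemma ext_scaleAr (a : k) f g : a *: (f * g) = f * (a *: g).
Proof.
apply/ffunP=> A; rewrite !ffunE scaler_sumr; apply: eq_bigr => B _.
by rewrite ffunE /GRing.scale /= mulrCA.
Qed.

HB.instance Definition _ :=
  GRing.Lalgebra_isAlgebra.Build k (exterior k n) ext_scaleAr.

Definition ext_basis A : exterior k n := [ffun B : {set 'I_n} => (B == A)%:R].

Definition ext_var (i : 'I_n) : exterior k n := ext_basis [set i].

Definition ext_deg1 f : Prop :=
  exists c : 'I_n -> k, f = \sum_(i < n) c i *: ext_var i.

Lemma ext_basisM B C : [disjoint B & C] ->
  ext_basis B * ext_basis C
  = (-1) ^+ inversions B C *: ext_basis (B :|: C).
Proof.
move=> dBC; apply/ffunP=> A; rewrite !ffunE.
have eC : (B :|: C) :\: B = C.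
  by rewrite setDUl setDv set0U; apply/setDidPl; rewrite disjoint_sym.
have [-> | neA] := eqVneq A (B :|: C).
  rewrite (bigD1 B) ?subsetUl //= big1 => [|X /andP[_ /negPf nX]]; last first.
    by rewrite ffunE nX mulr0 mul0r.
  by rewrite addr0 !ffunE eC !eqxx /GRing.scale /= !mulr1.
rewrite scaler0 big1 // => X sXA; rewrite !ffunE.
have [eX | _] := eqVneq X B; last by rewrite mulr0 mul0r.
have [eA | _] := eqVneq (A :\: X) C; last by rewrite mulr0.
by case/eqP: neA; rewrite -eA -eX -[LHS](setID A X) (setIidPr sXA).
Qed.

Lemma ext_basisM0 B C : ~~ [disjoint B & C] -> ext_basis B * ext_basis C = 0.
Proof.
move=> dBC; apply/ffunP=> A; rewrite !ffunE big1 // => X sXA; rewrite !ffunE.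
have [eX | _] := eqVneq X B; last by rewrite mulr0 mul0r.
have [eA | _] := eqVneq (A :\: X) C; last by rewrite mulr0.
case/negP: dBC; rewrite -eA -eX disjoint_sym disjoints_subset.
by apply/subsetP => x; rewrite !inE => /andP[].
Qed.

Lemma ext_varxx i : ext_var i * ext_var i = 0.
Proof. by apply: ext_basisM0; rewrite disjoints1 inE eqxx. Qed.

Lemma ext_var_anticomm i j : ext_var i * ext_var j = - (ext_var j * ext_var i).
Proof.
have [-> | nij] := eqVneq i j; first by rewrite !ext_varxx oppr0.
have inv1 (a b : 'I_n) : inversions [set a] [set b] = (b < a)%N.
  rewrite /inversions; case: (boolP (b < a)%N) => ba.
    by apply/eqP/cards1P; exists (a, b); apply/setP=> -[x y];
      rewrite !inE xpair_eqE /=; case: eqP => //= ->; case: eqP => //= ->.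
  apply: eq_card0 => -[x y]; rewrite !inE /=.
  by apply/negbTE/negP => /andP[/andP[/eqP-> /eqP->]]; apply/negP.
rewrite !ext_basisM ?disjoints1 ?inE 1?eq_sym // ?(negPf nij) //; last first.
  by rewrite eq_sym.
rewrite (setUC [set j]) !inv1 -scaleNr; congr (_ *: _).
by case: ltngtP nij => [||/val_inj->]; rewrite ?eqxx //= ?opprK.
Qed.

Lemma ext_basisE A : ext_basis A = \prod_(i <- enum A) ext_var i.
Proof.
have sA : sorted (fun i j : 'I_n => i < j)%N (enum A).
  rewrite /enum_mem -enumT; apply: sorted_filter => [? ? ?|]; first exact: ltn_trans.
  by have := iota_ltn_sorted 0 n; rewrite -val_enum_ord sorted_map.
rewrite -{1}[A]set_enum; elim: (enum A) sA => [_|a s IHs] /=.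
  by rewrite big_nil; apply/ffunP=> B; rewrite !ffunE; congr ((_ == _)%:R);
    apply/setP=> x; rewrite !inE.
rewrite path_sortedE => [/andP[/allP lt_as /IHs]|? ? ?]; last exact: ltn_trans.
rewrite big_cons => <-; rewrite ext_basisM; last first.
  by rewrite disjoints1 inE; apply/negP => /lt_as; rewrite ltnn.
suff -> : inversions [set a] [set x in s] = 0%N.
  by rewrite expr0 scale1r; congr ext_basis; apply/setP=> x; rewrite !inE.
apply: eq_card0 => -[x y]; rewrite !inE /=; apply/negbTE.
apply/negP => /andP[/andP[/eqP-> /lt_as]] /ltnW.
by rewrite leqNgt => /negPf->.
Qed.

End ExteriorRing.

Section Spans.
Variable R : nzRingType.

Definition submod_span (M : lmodType R) (X : M -> Prop) : M -> Prop :=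
  fun x => exists2 s : seq (R * M),
    (forall p, p \in s -> X p.2) & x = \sum_(p <- s) p.1 *: p.2.

Definition ideal_span (X : R -> Prop) : R -> Prop :=
  fun x => exists2 s : seq (R * R * R),
    (forall p, p \in s -> X p.1.2) & x = \sum_(p <- s) p.1.1 * p.1.2 * p.2.

(** Quotient modules are handled through representatives: below, a submodule
    [N] of [M] stands for the module [M / N]. Thus the quotient of [M / N] by
    the submodule [(s)(M / N)] is represented by [N + (s)M]. *)
Definition quot_seq (M : lmodType R) (N : M -> Prop) (s : seq R) : M -> Prop :=
  submod_span (fun x => N x \/ exists2 a, a \in s & exists y, x = a *: y).

Definition nonzerodivisor (M : lmodType R) (N : M -> Prop) (f : R) : Prop :=
  forall y : M, N (f *: y) -> N y.

(** [{y in M/N | l y = 0} = l (M/N)]. *)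
Definition ext_regular (M : lmodType R) (N : M -> Prop) (l : R) : Prop :=
  forall y : M, N (l *: y) <-> exists z : M, N (y - l *: z).

End Spans.

Section Depth.
Variables (k : comNzRingType) (n : nat).

Definition regular_seq_E (M : lmodType (exterior k n)) (N : M -> Prop)
    (s : seq (exterior k n)) : Prop :=
  (forall l, l \in s -> ext_deg1 l) /\
  (forall i, (i < size s)%N -> ext_regular (quot_seq N (take i s)) s`_i).

Definition irrelevant_ideal : {mpoly k[n]} -> Prop :=
  ideal_span (fun f => exists i : 'I_n, f = 'X_i).

Definition regular_seq_S (M : lmodType {mpoly k[n]}) (N : M -> Prop)
    (s : seq {mpoly k[n]}) : Prop :=
  [/\ forall f, f \in s -> irrelevant_ideal f,
      forall i, (i < size s)%N -> nonzerodivisor (quot_seq N (take i s)) s`_i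
    & ~ (forall x, quot_seq N s x)].

End Depth.

(** [d] is the maximum of the lengths of the sequences satisfying [P]; [d] is
    an integer because the depth formulas involve integer subtractions. *)
Definition is_max_length (T : Type) (P : seq T -> Prop) (d : int) : Prop :=
  (exists2 s, P s & (size s)%:Z = d) /\ (forall s, P s -> (size s)%:Z <= d).

Definition depth_E (k : comNzRingType) (n : nat)
    (M : lmodType (exterior k n)) (N : M -> Prop) (d : int) : Prop :=
  is_max_length (regular_seq_E N) d.

Definition depth_S (k : comNzRingType) (n : nat)
    (M : lmodType {mpoly k[n]}) (N : M -> Prop) (d : int) : Prop :=
  is_max_length (regular_seq_S N) d.

Record sgraph (n : nat) := SGraph {
  adj :> rel 'I_n;
  adj_sym : ssrbool.symmetric adj;
  adj_irr : irreflexive adj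
}.

Section EdgeIdeals.
Variables (k : comNzRingType) (n : nat) (G : sgraph n).

Definition edge_ideal_E : exterior k n -> Prop :=
  ideal_span (fun f => exists a b, adj G a b /\ f = ext_var k a * ext_var k b).

Definition edge_ideal_S : {mpoly k[n]} -> Prop :=
  ideal_span (fun f => exists a b, adj G a b /\ f = 'X_a * 'X_b).

Definition graph_depth_E (d : int) : Prop :=
  @depth_E k n (exterior k n)^o edge_ideal_E d.

Definition graph_depth_S (d : int) : Prop :=
  @depth_S k n {mpoly k[n]}^o edge_ideal_S d.

End EdgeIdeals.

Section Ferrers.
Variables (m : nat) (lam : nat -> nat).

(** The sequence is [lam 1, ..., lam m]; the other values of [lam] are
    irrelevant. With [0]-based ordinals, [lshift _ i] is the vertex v_(i+1) and
    [rshift _ j] is the vertex w_(j+1). *)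
Definition ferrers_adj : rel 'I_(m + lam 1) := fun u v =>
  match split u, split v with
  | inl i, inr j | inr j, inl i => (j.+1 <= lam i.+1)%N
  | _, _ => false
  end.

Lemma ferrers_adj_sym : ssrbool.symmetric ferrers_adj.
Proof. by move=> u v; rewrite /ferrers_adj; case: split; case: split. Qed.

Lemma ferrers_adj_irr : irreflexive ferrers_adj.
Proof. by move=> u; rewrite /ferrers_adj; case: split. Qed.

Definition ferrers_graph : sgraph (m + lam 1) :=
  SGraph ferrers_adj_sym ferrers_adj_irr.

End Ferrers.

(** Since [m >= 1] in use, the initial value [F 1] is among [F 1, ..., F m]. *)
Definition min_upto (m : nat) (F : nat -> int) : int :=
  \big[Order.min/F 1%N]_(1 <= j < m.+1) F j.

(* Main.v *)
Require Import Defs.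
From mathcomp Require Import all_boot all_order all_algebra.
From mathcomp Require Import mpoly ring zify.

Set Implicit Arguments.
Unset Strict Implicit.
Unset Printing Implicit Defensive.

Import Order.TTheory GRing.Theory Num.Theory.
Local Open Scope ring_scope.

(** Since the [lam j] decrease strictly, [lam j + j] decreases weakly, so both
    minima are attained at [j = 1] and the two depths are [m] and [m - 1]. Write
    [x_i], [y_j] (counted from 0, so that [x_i] and [y_j] are adjacent for
    [j < lam (i + 1)]) for the vertices and for the variables.

    Lower bounds. Adding [x_0, x_1, ...] one after the other to the edge ideal
    gives a filtration of the quotient by the edge ideal whose sections are
    isomorphic to quotients of the whole ring by variables: the section of [x_i]
    is the quotient by the [x_l] with [l < i], by the neighbours [y_j] of [x_i]
    and, over the exterior algebra, by [x_i] itself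
    ([vertex_decomposition_regular], [link_x_avoiding]); what remains at the end
    is the quotient by all the [x_l]. Consider the elements
    [x_(t + e) - y_(lam (t + 1) - 1)] for [t < m - e], where [e] is 0 over the
    polynomial ring and 1 over the exterior algebra. In each section exactly one
    of the two terms is killed, so they act, up to sign, as distinct variables,
    and form a regular sequence there ([differences_regular]). A sequence that
    is regular on a submodule and on the quotient by it is regular on the whole
    module ([regular_seq_extension]). The two rings are treated at once: in both
    cases regularity of [t] says that the kernel of [t] is as small as it can be,
    namely 0, respectively the image of [t].

    Upper bound over the polynomial ring. If [a] has a neighbour and [C] is the
    set of the vertices not adjacent to [a], then [X_a e_C] represents a nonzero
    cohomology class of degree [#|C|] of the Koszul complex of all the variables
    on the quotient by the edge ideal. Each element of a regular sequence lowers
    the degree of such a class by one ([koszul_regular_seq_size]), so regular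
    sequences have length at most [#|C|]. For [a = x_0] this is [m].

    Upper bound over the exterior algebra. The vertices other than [a] and its
    neighbours are [#|C| - 1] in number, so [#|C|] linear forms have a nontrivial
    combination that is supported on [a] and its neighbours. Such a
    form is not regular ([star_form_not_regular]), although every nontrivial
    combination of the elements of a regular sequence is
    ([regular_on_lift_seq]). *)

(** * Submodules and quotients by normal elements *)

Definition submodule (R : nzRingType) (M : lmodType R) (N : M -> Prop) : Prop :=
  [/\ N 0, forall x y, N x -> N y -> N (x + y) & forall r x, N x -> N (r *: x)].

(** For such [t] and a left submodule [A], the set [t A] is a left submodule,
    although the exterior algebra is not commutative. *)
Definition normal_elt (R : nzRingType) (t : R) : Prop :=
  forall r, exists r', r * t = t * r'.

Section Submodules.
Variables (R : nzRingType) (M : lmodType R).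
Implicit Types (A B C N : M -> Prop) (t : R) (s : seq R).

Definition whole : M -> Prop := fun _ => True.

Lemma submodule_whole : submodule whole.
Proof. by []. Qed.

Lemma submoduleB N x y : submodule N -> N x -> N y -> N (x - y).
Proof. by case=> _ ND NZ Nx Ny; apply: ND => //; rewrite -scaleN1r; apply: NZ. Qed.

Lemma submodule_addKr N x y : submodule N -> N y -> N (x + y) <-> N x.
Proof.
move=> sN Ny; split=> [Nxy|Nx]; last by case: sN => _ ND _; apply: ND.
by rewrite -(addrK y x); apply: submoduleB.
Qed.

Lemma submodule_subKr N x y : submodule N -> N y -> N (x - y) <-> N x.
Proof.
move=> sN Ny; split=> [Nxy|Nx]; last exact: submoduleB.
by rewrite -(subrK y x); case: sN => _ ND _; apply: ND.
Qed.

Lemma submodule_sum N (I : eqType) (r : seq I) (F : I -> M) : submodule N ->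
  (forall i, i \in r -> N (F i)) -> N (\sum_(i <- r) F i).
Proof.
case=> N0 ND _; elim: r => [_|i r IHr NF]; first by rewrite big_nil.
rewrite big_cons; apply: ND; first by apply: NF; rewrite mem_head.
by apply: IHr => j jr; apply: NF; rewrite inE jr orbT.
Qed.

(** The submodule [B + t A]. *)
Definition add_mul A B t : M -> Prop :=
  fun x => exists a, A a /\ B (x - t *: a).

Lemma add_mul_submodule A B t : submodule A -> submodule B -> normal_elt t ->
  submodule (add_mul A B t).
Proof.
move=> sA sB nt; split.
- by exists 0; case: sA sB => [A0 _ _] [B0 _ _]; rewrite scaler0 subr0.
- move=> x y [a [Aa Bx]] [b [Ab By]]; exists (a + b).
  case: sA sB => [_ AD _] [_ BD _]; split; first exact: AD.
  by rewrite scalerDr opprD addrACA; apply: BD.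
- move=> r x [a [Aa Bx]]; have [r' e] := nt r; exists (r' *: a).
  case: sA sB => [_ _ AZ] [_ _ BZ]; split; first exact: AZ.
  by rewrite scalerA -e -scalerA -scalerBr; apply: BZ.
Qed.

Lemma add_mul_sub A B t x : submodule A -> B x -> add_mul A B t x.
Proof. by case=> A0 _ _ Bx; exists 0; rewrite scaler0 subr0. Qed.

Lemma add_mul_scale A B t a : submodule B -> A a -> add_mul A B t (t *: a).
Proof. by case=> B0 _ _ Aa; exists a; rewrite subrr. Qed.

Lemma submod_span_submodule (X : M -> Prop) : submodule (submod_span X).
Proof.
split.
- by exists [::]; rewrite ?big_nil.
- move=> x y [s Xs ->] [s' Xs' ->]; exists (s ++ s'); last by rewrite big_cat.
  by move=> p; rewrite mem_cat => /orP[/Xs | /Xs'].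
- move=> r x [s Xs ->]; exists [seq (r * p.1, p.2) | p <- s].
    by move=> _ /mapP[p ps ->]; exact: (Xs p).
  by rewrite big_map scaler_sumr; apply: eq_bigr => p _; rewrite scalerA.
Qed.

Lemma sub_submod_span (X : M -> Prop) x : X x -> submod_span X x.
Proof.
move=> Xx; exists [:: (1, x)]; first by move=> p; rewrite inE => /eqP->.
by rewrite big_seq1 scale1r.
Qed.

Lemma submod_span_min (X N : M -> Prop) x : submodule N ->
  (forall y, X y -> N y) -> submod_span X x -> N x.
Proof.
move=> sN XN [s Xs ->]; apply: submodule_sum => // p ps.
by case: sN => _ _; apply; apply/XN/Xs.
Qed.

Lemma quot_seq_submodule N s : submodule (quot_seq N s).
Proof. exact: submod_span_submodule. Qed.

Lemma quot_seq_base N s x : N x -> quot_seq N s x.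
Proof. by move=> Nx; apply: sub_submod_span; left. Qed.

Lemma quot_seq_scale N s t a : t \in s -> quot_seq N s (t *: a).
Proof. by move=> ts; apply: sub_submod_span; right; exists t => //; exists a. Qed.

Lemma quot_seq_min N s N' x : submodule N' -> (forall y, N y -> N' y) ->
  (forall t y, t \in s -> N' (t *: y)) -> quot_seq N s x -> N' x.
Proof.
move=> sN' NN' sN; apply: submod_span_min => // y [/NN' //|[t ts [a ->]]].
exact: sN.
Qed.

Lemma quot_seq_nil N x : submodule N -> quot_seq N [::] x <-> N x.
Proof. by move=> sN; split; [apply: quot_seq_min|apply: quot_seq_base]. Qed.

Lemma quot_seq_cons N t s x : submodule N ->
  quot_seq N (t :: s) x <-> quot_seq (add_mul whole N t) s x.
Proof.
move=> sN; split; apply: quot_seq_min; try exact: quot_seq_submodule.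
- by move=> y Ny; apply: quot_seq_base; apply: add_mul_sub.
- move=> u y; rewrite inE => /predU1P[-> | us]; last exact: quot_seq_scale.
  by apply: quot_seq_base; apply: add_mul_scale.
- move=> y [a [_ Na]]; rewrite -(subrK (t *: a) y).
  case: (quot_seq_submodule N (t :: s)) => _ QD _; apply: QD.
    exact: quot_seq_base.
  by apply: quot_seq_scale; rewrite mem_head.
- by move=> u y us; apply: quot_seq_scale; rewrite inE us orbT.
Qed.

Lemma quot_seq_rcons N s t x : normal_elt t ->
  quot_seq N (rcons s t) x <-> add_mul whole (quot_seq N s) t x.
Proof.
move=> nt; have sQ := quot_seq_submodule N s; split.
  apply: quot_seq_min; first exact: add_mul_submodule.
    by move=> y Ny; apply: add_mul_sub => //; apply: quot_seq_base.
  move=> u y; rewrite mem_rcons inE => /predU1P[-> | us].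
    exact: add_mul_scale.
  by apply: add_mul_sub => //; apply: quot_seq_scale.
move=> [a [_ Qa]]; rewrite -(subrK (t *: a) x).
case: (quot_seq_submodule N (rcons s t)) => _ QD _; apply: QD.
  apply: quot_seq_min Qa; first exact: quot_seq_submodule.
    by move=> y; apply: quot_seq_base.
  by move=> u y us; apply: quot_seq_scale; rewrite mem_rcons inE us orbT.
by apply: quot_seq_scale; rewrite mem_rcons mem_head.
Qed.

End Submodules.

(** * Regular sequences, for both notions at once *)

Section Regularity.
Variables (R : nzRingType) (e : bool).
Implicit Types (t : R) (s : seq R).

(** The kernel of multiplication by a regular [t] is the image of
    multiplication by [ker_mult t]: [e] is false over the polynomial ring, where regular means
    injective, and true over the exterior algebra, where it means that the
    kernel is the image. *)
Definition ker_mult t : R := if e then t else 0.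

Section OneModule.
Variable M : lmodType R.
Implicit Types (A B C N : M -> Prop).

(** The module is [A / B], for [B] contained in [A]; the sections of a
    filtration are of this form. *)
Definition regular_on A B t : Prop :=
  forall y, A y -> B (t *: y) -> add_mul A B (ker_mult t) y.

Fixpoint regular_seq_on A B s : Prop :=
  if s is t :: s' then regular_on A B t /\ regular_seq_on A (add_mul A B t) s'
  else True.

End OneModule.

(** The hypotheses say that [phi] induces an isomorphism from [A1 / B1] onto
    [A2 / B2]. *)
Lemma regular_seq_transfer (M1 M2 : lmodType R) (phi : M1 -> M2)
    (A1 B1 : M1 -> Prop) (A2 B2 : M2 -> Prop) s :
    (forall x y, phi (x - y) = phi x - phi y) ->
    (forall r x, phi (r *: x) = r *: phi x) ->
    submodule A1 -> submodule B1 -> submodule A2 -> submodule B2 ->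
    (forall t, t \in s -> normal_elt t) ->
    (forall a, A1 a -> A2 (phi a)) ->
    (forall y, A2 y -> exists a, A1 a /\ B2 (y - phi a)) ->
    (forall a, A1 a -> B2 (phi a) <-> B1 a) ->
  regular_seq_on A1 B1 s -> regular_seq_on A2 B2 s.
Proof.
move=> phiB phiZ sA1 + sA2 + ns A12 A21.
elim: s B1 B2 ns A21 => //= t s IHs B1 B2 ns A21 sB1 sB2 B12 [reg1 regs].
have nt : normal_elt t by apply: ns; rewrite mem_head.
have sA1Z r x : A1 x -> A1 (r *: x) by case: sA1 => _ _; apply.
split=> [y A2y B2ty|].
  have [a [A1a B2a]] := A21 y A2y.
  have B1ta : B1 (t *: a).
    apply/(B12 _ (sA1Z t a A1a)); rewrite phiZ.
    rewrite -(subKr (t *: y) (t *: phi a)) -scalerBr; apply/submodule_subKr => //.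
    by case: sB2 => _ _; apply.
  have [z [A1z B1z]] := reg1 a A1a B1ta.
  exists (phi z); split; first exact: A12.
  rewrite -[y](subrK (phi a)) -addrA -phiZ -phiB.
  apply/submodule_addKr => //; apply/B12 => //.
  by apply: submoduleB => //; apply: sA1Z.
apply: IHs regs; try exact: add_mul_submodule.
- by move=> u us; apply: ns; rewrite inE us orbT.
- by move=> y /A21[a [A1a B2a]]; exists a; split=> //; apply: add_mul_sub.
move=> a A1a; split=> [[y [A2y B2y]]|[a' [A1a' B1a']]].
  have [a' [A1a' B2a']] := A21 y A2y; exists a'; split=> //.
  apply/B12; first by apply: submoduleB => //; apply: sA1Z.
  rewrite phiB phiZ -[phi a](subrK (t *: y)) -addrA -scalerBr.
  by case: sB2 => _ BD BZ; apply: BD => //; apply: BZ.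
exists (phi a'); split; first exact: A12.
rewrite -phiZ -phiB; apply/B12 => //.
by apply: submoduleB => //; apply: sA1Z.
Qed.

Lemma eq_regular_seq (M : lmodType R) (A B B' : M -> Prop) s :
    submodule A -> submodule B -> submodule B' ->
    (forall t, t \in s -> normal_elt t) ->
    (forall x, A x -> B' x <-> B x) ->
  regular_seq_on A B s -> regular_seq_on A B' s.
Proof.
move=> sA sB sB' ns BB'; apply: (@regular_seq_transfer _ _ id) => //.
by move=> y Ay; exists y; rewrite subrr; case: sB'.
Qed.

(** With [u := ker_mult t], view multiplications by [u] and [t] as a complex
    [M -> M -> M]. Exactness of this complex on [B / C] and on [A / B] gives
    exactness on [A / C], and it makes [B / (C + t B)] a submodule of
    [A / (C + t A)], which allows induction on the sequence. *)
Lemma regular_seq_extension (M : lmodType R) (A B C : M -> Prop) s :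
    submodule A -> submodule B -> submodule C ->
    (forall x, B x -> A x) -> (forall x, C x -> B x) ->
    (forall t, t \in s -> normal_elt t) ->
    (forall t, t \in s -> t * ker_mult t = 0) ->
  regular_seq_on B C s -> regular_seq_on A B s -> regular_seq_on A C s.
Proof.
move=> sA; elim: s B C => //= t s IHs B C sB sC BA CB ns ts0.
move=> [regB regsB] [regA regsA].
have nt : normal_elt t by apply: ns; rewrite mem_head.
have t0 : t * ker_mult t = 0 by apply: ts0; rewrite mem_head.
have nker : normal_elt (ker_mult t).
  by rewrite /ker_mult; case: e => // r; exists 0; rewrite mul0r mulr0.
have AZ r x : A x -> A (r *: x) by case: sA => _ _; apply.
have [_ AD _] := sA; have [B0 BD BZ] := sB; have [_ CD CZ] := sC.
(* Correct [y] by a multiple of [ker_mult t], which [t] kills, to land in [B]. *)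
have lift y : A y -> C (t *: y) -> exists a, [/\ A a, B (y - ker_mult t *: a) &
    C (t *: (y - ker_mult t *: a))].
  move=> Ay Cty; have [a [Aa Ba]] := regA y Ay (CB _ Cty).
  by exists a; split=> //; rewrite scalerBr scalerA t0 scale0r subr0.
split=> [y Ay Cty|].
  have [a [Aa Ba Cta]] := lift y Ay Cty.
  have [b [Bb Cb]] := regB _ Ba Cta.
  exists (a + b); split; first by apply: AD => //; apply: BA.
  by rewrite scalerDr opprD addrA.
have CBt x : add_mul A C t x -> add_mul A B t x.
  by move=> [a [Aa Ca]]; exists a; split=> //; apply: CB.
apply: (IHs (add_mul A B t)) regsA => //; try exact: add_mul_submodule.
- move=> x [a [Aa Ba]]; rewrite -(subrK (t *: a) x).
  by apply: AD; [apply: BA|apply: AZ].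
- by move=> u us; apply: ns; rewrite inE us orbT.
- by move=> u us; apply: ts0; rewrite inE us orbT.
apply: (@regular_seq_transfer M M id B (add_mul B C t)) regsB => //;
  try exact: add_mul_submodule.
- by move=> u us; apply: ns; rewrite inE us orbT.
- by move=> b Bb; exact: add_mul_sub.
- move=> y [a [Aa Ba]]; exists (y - t *: a); split=> //.
  by rewrite opprB addrC subrK; apply: add_mul_scale.
move=> b Bb; split=> [[a [Aa Ca]]|[a [Ba Ca]]]; last first.
  by exists a; split=> //; apply: BA.
(* [t a] lies in [B], so [a] can be moved into [B] without changing [t a]: this
   is the equality of [B :&: (C + t A)] and [C + t B]. *)
have Bta : B (t *: a).
  by rewrite -(subKr b (t *: a)); apply: submoduleB => //; apply: CB.
have [a' [Aa' Ba']] := regA _ Aa Bta.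
exists (a - ker_mult t *: a'); split=> //.
by rewrite scalerBr scalerA t0 scale0r subr0.
Qed.

Lemma regular_seq_quot_seq (M : lmodType R) (N : M -> Prop) s :
    submodule N -> (forall t, t \in s -> normal_elt t) ->
    regular_seq_on (@whole R M) N s ->
  forall i, (i < size s)%N -> regular_on (@whole R M) (quot_seq N (take i s)) s`_i.
Proof.
elim: s N => //= t s IHs N sN ns [regt regs] [_|i i_lt] /=.
  move=> y _ /(quot_seq_nil _ sN) Nty; have [z [_ Nz]] := regt y I Nty.
  by exists z; split=> //; apply/quot_seq_nil.
have nt : normal_elt t by apply: ns; rewrite mem_head.
have sN' : submodule (add_mul (@whole R M) N t) by apply: add_mul_submodule.
move=> y _ /quot_seq_cons => /(_ sN) Qy.
have ns' u : u \in s -> normal_elt u by move=> us; apply: ns; rewrite inE us orbT.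
have [z [_ Qz]] := IHs _ sN' ns' regs i i_lt y I Qy.
by exists z; split=> //; apply/quot_seq_cons.
Qed.

End Regularity.

(** * Monomial ideals given by simplicial complexes *)

Section Complexes.
Variable n : nat.
Implicit Types (D : pred {set 'I_n}) (A C : {set 'I_n}) (z : 'I_n).

Definition down_closed D : Prop := forall A B : {set 'I_n}, A \subset B -> D B -> D A.

Definition deletion z D : pred {set 'I_n} := fun A => (z \notin A) && D A.

(** The annihilator of the variable [z] modulo the ideal of [D] is the ideal of
    this family. The flag [e] marks the exterior algebra, where [z] kills
    itself. *)
Definition link (e : bool) z D : pred {set 'I_n} :=
  fun A => (e ==> (z \notin A)) && D (z |: A).

Definition avoiding C : pred {set 'I_n} := fun A => [disjoint A & C].

Lemma down_closed_deletion z D : down_closed D -> down_closed (deletion z D).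
Proof.
move=> dD A B sAB /andP[zB DB]; apply/andP; split; last exact: dD DB.
by apply: contra zB; apply: (subsetP sAB).
Qed.

Lemma down_closed_avoiding C : down_closed (avoiding C).
Proof. by move=> A B sAB; apply: disjointWl. Qed.

Lemma avoiding_setU1 z C A : avoiding (z |: C) A = deletion z (avoiding C) A.
Proof.
rewrite /deletion /avoiding ![[disjoint A & _]]disjoint_sym !disjoints_subset.
by rewrite subUset sub1set inE.
Qed.

Lemma avoidingU1 z C A : avoiding C (z |: A) = (z \notin C) && avoiding C A.
Proof. by rewrite /avoiding !disjoints_subset subUset sub1set inE. Qed.

End Complexes.

(** The common features of squarefree monomial ideals in the two rings: [X]
    gives the variables and [N D] is the Stanley-Reisner ideal of the complex
    [D], spanned by the monomials whose support is not in [D]. *)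
Record monomial_model (e : bool) (R : nzRingType) (n : nat)
    (X : 'I_n -> R) (N : pred {set 'I_n} -> R^o -> Prop) : Prop := {
  mono_submodule (D : pred {set 'I_n}) : down_closed D -> submodule (N D);
  mono_sub (D D' : pred {set 'I_n}) y : (forall A, D' A -> D A) -> N D y -> N D' y;
  mono_void y : N pred0 y;
  mono_linkl z (D : pred {set 'I_n}) y : N D (X z * y) <-> N (link e z D) y;
  mono_linkr z (D : pred {set 'I_n}) y : N D (y * X z) <-> N (link e z D) y;
  mono_divl z (D : pred {set 'I_n}) y : N (deletion z D) y -> exists a, N D (y - X z * a);
  mono_divr z (D : pred {set 'I_n}) y : N (deletion z D) y -> exists a, N D (y - a * X z);
  mono_normal i j : normal_elt (X i - X j);
  mono_square i j : e -> (X i - X j) * (X i - X j) = 0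
}.

Section MonomialModel.
Variables (e : bool) (R : nzRingType) (n : nat).
Variables (X : 'I_n -> R) (N : pred {set 'I_n} -> R^o -> Prop).
Hypothesis monoN : monomial_model e X N.
Implicit Types (D : pred {set 'I_n}) (C : {set 'I_n}) (ps : seq ('I_n * 'I_n)).

Definition differences ps : seq R := [seq X p.1 - X p.2 | p <- ps].

Lemma differences_normal ps t : t \in differences ps -> normal_elt t.
Proof. by case/mapP=> p _ ->; apply: mono_normal monoN _ _. Qed.

Lemma differences_ker_mult ps t : t \in differences ps -> t * ker_mult e t = 0.
Proof.
case/mapP=> p _ ->; rewrite /ker_mult; case: ifP => [ee|_]; last exact: mulr0.
exact: (mono_square monoN).
Qed.

Lemma mono_mem C z y : z \in C -> N (avoiding C) (X z * y).
Proof.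
move=> zC; apply/(mono_linkl monoN).
apply: (mono_sub monoN) (mono_void monoN y) => A /andP[_].
by rewrite avoidingU1 zC.
Qed.

(** An element that acts on the quotient by the variables in [C] as plus or
    minus a variable outside [C] is regular there, and brings that variable into
    the ideal. *)
Lemma regular_variable C i t (b : bool) ps :
    i \notin C -> normal_elt t -> t * ker_mult e t = 0 ->
    (forall a, N (avoiding C) (t * a - X i * ((-1) ^+ b * a))) ->
    regular_seq_on e (@whole R R^o) (N (avoiding (i |: C))) (differences ps) ->
  regular_seq_on e (@whole R R^o) (N (avoiding C)) (t :: differences ps).
Proof.
move=> iC nt t0 tX regs.
have sN C' : submodule (N (avoiding C')).
  by apply: (mono_submodule monoN); apply: down_closed_avoiding.
have bb a : (-1) ^+ b * ((-1) ^+ b * a) = a :> R by rewrite mulrA -expr2 sqrr_sign mul1r.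
have NiC y : N (avoiding (i |: C)) y -> add_mul (@whole R R^o) (N (avoiding C)) t y.
  move=> Ny; have [|a Na] := @mono_divl _ _ _ _ _ monoN i (avoiding C) y.
    by apply: (mono_sub monoN) Ny => A; rewrite avoiding_setU1.
  exists ((-1) ^+ b * a); split=> //.
  have := submoduleB (sN C) Na (tX ((-1) ^+ b * a)).
  by rewrite bb opprB addrA addrNK.
split=> [y _ Nty|].
  have NXy : N (avoiding C) (X i * ((-1) ^+ b * y)).
    by rewrite -(subKr (t * y) (X i * _)); apply: (submoduleB (sN C) Nty (tX y)).
  have Ny : N (link e i (avoiding C)) y.
    rewrite -(bb y); have sL : submodule (N (link e i (avoiding C))).
      apply: (mono_submodule monoN) => A B sAB /andP[iB DB]; apply/andP; split.
        by move: iB; case: (e) => //=; apply: contra; apply: (subsetP sAB).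
      by apply: down_closed_avoiding DB; apply: setUS.
    by case: sL => _ _; apply; apply/(mono_linkl monoN).
  have iCA A : avoiding (i |: C) A -> i \notin A.
    by rewrite avoiding_setU1 => /andP[].
  rewrite /ker_mult; move: Ny; case: (e) => Ny.
    apply: NiC; apply: (mono_sub monoN) Ny => A iCA'; apply/andP; split.
      exact: iCA.
    by move: iCA'; rewrite avoiding_setU1 => /andP[_]; rewrite avoidingU1 iC.
  exists 0; split=> //; rewrite scaler0 subr0; apply: (mono_sub monoN) Ny => A.
  by rewrite /link /= avoidingU1 iC.
apply: eq_regular_seq regs => //; first exact: add_mul_submodule.
  exact: differences_normal.
move=> y _; split; last exact: NiC.
have NN x : N (avoiding C) x -> N (avoiding (i |: C)) x.
  by apply: (mono_sub monoN) => A; rewrite avoiding_setU1 => /andP[].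
move=> [a [_ /NN Na]]; rewrite -(subrK (t *: a) y); case: (sN (i |: C)) => _ ND _.
apply: (ND) => //; rewrite -(subrK (X i * ((-1) ^+ b * a)) (t *: a)).
apply: ND.
  exact/NN/tX.
by apply: mono_mem; rewrite setU11.
Qed.

(** Modulo the variables in [C], each difference becomes up to sign its term
    outside [C], and these terms are distinct variables. *)
Lemma differences_regular C ps :
    uniq (unzip1 ps ++ unzip2 ps) ->
    (forall p, p \in ps -> (p.1 \in C) != (p.2 \in C)) ->
  regular_seq_on e (@whole R R^o) (N (avoiding C)) (differences ps).
Proof.
elim: ps C => //= -[i j] ps IHs C /=.
rewrite mem_cat negb_or cat_uniq /= negb_or -!andbA.
move=> /and5P[i1 i2 u1 j1 /and3P[n12 j2 u2]] crossing.
have ups : uniq (unzip1 ps ++ unzip2 ps) by rewrite cat_uniq u1 n12.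
have IH x : x \notin unzip1 ps -> x \notin unzip2 ps ->
  regular_seq_on e (@whole R R^o) (N (avoiding (x |: C))) (differences ps).
  move=> x1 x2; apply: IHs => // p pps; rewrite !inE.
  have /negPf-> : p.1 != x by apply: contraNneq x1 => <-; apply: map_f.
  have /negPf-> : p.2 != x by apply: contraNneq x2 => <-; apply: map_f.
  by apply: crossing; rewrite inE pps orbT.
have NX z a : z \in C -> N (avoiding C) (- (X z * a)).
  by move=> zC; rewrite -mulrN; apply: mono_mem.
have nij : normal_elt (X i - X j) by apply: mono_normal monoN _ _.
have ij0 : (X i - X j) * ker_mult e (X i - X j) = 0.
  by apply: (@differences_ker_mult [:: (i, j)]); rewrite mem_head.
have := crossing (i, j) (mem_head _ _); rewrite /=.
case: (boolP (i \in C)) => iC jC.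
  apply: (@regular_variable C j _ true) => //; last exact: IH.
  by move=> a; rewrite expr1 mulN1r mulrN opprK mulrBl subrK; apply: mono_mem.
have {}jC : j \in C by move: jC; case: (j \in C).
apply: (@regular_variable C i _ false) => //; last first.
  by apply: IH => //; move: i2; rewrite inE negb_or => /andP[].
by move=> a; rewrite expr0 mul1r mulrBl addrC addKr; apply: NX.
Qed.

(** Multiplication by [X z] embeds the quotient given by the link of [z] into
    the one given by [D], with cokernel given by the deletion of [z]. *)
Lemma vertex_decomposition_regular D z C ps :
    down_closed D -> link e z D =1 avoiding C ->
    regular_seq_on e (@whole R R^o) (N (avoiding C)) (differences ps) ->
    regular_seq_on e (@whole R R^o) (N (deletion z D)) (differences ps) ->
  regular_seq_on e (@whole R R^o) (N D) (differences ps).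
Proof.
move=> dD linkC regC regdel.
have dC := @down_closed_avoiding n C.
have ddel := @down_closed_deletion n z D dD.
have sub := mono_submodule monoN.
apply: regular_seq_extension regdel => //; try exact: sub.
- by move=> y; apply: (mono_sub monoN) => A /andP[].
- exact: differences_normal.
- exact: differences_ker_mult.
apply: (@regular_seq_transfer R e R^o R^o (fun a => a * X z)) regC => //;
  try exact: sub.
- by move=> x y; rewrite mulrBl.
- by move=> r x; apply/esym/mulrA.
- exact: differences_normal.
- move=> a _; apply/(mono_linkr monoN); apply: (mono_sub monoN) (mono_void monoN a).
  by move=> A /andP[_ /andP[]]; rewrite setU11.
- by move=> y /(mono_divr monoN)[a Na]; exists a.
move=> a _; rewrite (mono_linkr monoN).
by split; apply: (mono_sub monoN) => A; rewrite linkC.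
Qed.

End MonomialModel.

(** * Ferrers graphs *)

Definition independent (n : nat) (G : sgraph n) : pred {set 'I_n} :=
  fun A => [forall a in A, forall b in A, ~~ adj G a b].

Lemma independentP n (G : sgraph n) (A : {set 'I_n}) :
  reflect (forall a b, a \in A -> b \in A -> ~~ adj G a b) (independent G A).
Proof.
apply: (iffP forall_inP) => [indA a b aA bA|indA a aA].
  by have /forall_inP := indA a aA; apply.
by apply/forall_inP => b; apply: indA.
Qed.

Lemma down_closed_independent n (G : sgraph n) : down_closed (independent G).
Proof.
move=> A B /subsetP sAB /independentP indB; apply/independentP => a b aA bA.
by apply: indB; apply: sAB.
Qed.

Section FerrersGraph.
Variables (m : nat) (lam : nat -> nat).
Hypotheses (m_gt0 : (0 < m)%N)
  (lam_decr : forall i : nat, (1 <= i < m)%N -> (lam i.+1 < lam i)%N)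
  (lam_gt0 : (0 < lam m)%N).
Local Notation G := (ferrers_graph m lam).

Lemma lam_ltn i j : (0 < i)%N -> (i < j)%N -> (j <= m)%N -> (lam j < lam i)%N.
Proof.
move=> i_gt0; elim: j => // j IHj; rewrite ltnS leq_eqVlt => /predU1P[<-|ij] jm.
  by apply: lam_decr; rewrite i_gt0.
apply: ltn_trans (IHj ij (ltnW jm)); apply: lam_decr.
by rewrite jm (leq_trans i_gt0 (ltnW ij)).
Qed.

Lemma lam_leq i j : (0 < i)%N -> (i <= j)%N -> (j <= m)%N -> (lam j <= lam i)%N.
Proof.
by move=> i0; rewrite leq_eqVlt => /predU1P[->//|ij] jm; apply/ltnW/lam_ltn.
Qed.

Lemma lam_pos i : (0 < i <= m)%N -> (0 < lam i)%N.
Proof. by case/andP=> i0 im; apply: leq_trans lam_gt0 (lam_leq i0 im (leqnn m)). Qed.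

(** Strict decrease makes [lam j + j] weakly decreasing, hence the minimum in
    the depth formulas is attained at [j = 1]. *)
Lemma lam_add_leq j : (0 < j <= m)%N -> (lam j + j <= lam 1 + 1)%N.
Proof.
case: j => // j /=; elim: j => // j IHj jm.
by apply: leq_trans (IHj (ltnW jm)); rewrite addnS -addSn leq_add2r lam_decr.
Qed.

Local Notation x_ i := (@lshift m (lam 1) i).
Local Notation y_ j := (@rshift m (lam 1) j).

Lemma ferrers_adj_xy i j : adj G (x_ i) (y_ j) = (j < lam i.+1)%N.
Proof. by rewrite /= /ferrers_adj (unsplitK (inl i)) (unsplitK (inr j)). Qed.

Lemma ferrers_adj_xx i i' : adj G (x_ i) (x_ i') = false.
Proof. by rewrite /= /ferrers_adj (unsplitK (inl i)) (unsplitK (inl i')). Qed.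

Lemma ferrers_adj_yy j j' : adj G (y_ j) (y_ j') = false.
Proof. by rewrite /= /ferrers_adj (unsplitK (inr j)) (unsplitK (inr j')). Qed.

Lemma ferrers_vertex_ind (P : 'I_(m + lam 1) -> Prop) :
  (forall i, P (x_ i)) -> (forall j, P (y_ j)) -> forall u, P u.
Proof. by move=> Px Py u; rewrite -(splitK u); case: split. Qed.

Lemma ferrers_independentP (A : {set 'I_(m + lam 1)}) :
  reflect (forall i j, x_ i \in A -> y_ j \in A -> (lam i.+1 <= j)%N)
    (independent G A).
Proof.
apply: (iffP (independentP _ _)) => [indA i j iA jA|indA].
  by rewrite leqNgt -ferrers_adj_xy indA.
apply: ferrers_vertex_ind => i; apply: ferrers_vertex_ind => j iA jA;
  rewrite ?ferrers_adj_xx ?ferrers_adj_yy ?(adj_sym _ (y_ _)) ?ferrers_adj_xy //.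
- by rewrite -leqNgt indA.
- by rewrite -leqNgt indA.
Qed.

(** The complex of the ideal spanned by the edge ideal and [x_l], [l < i]. *)
Definition x_avoiding (i : nat) : pred {set 'I_(m + lam 1)} :=
  fun A => independent G A && [forall l : 'I_m, (l < i)%N ==> (x_ l \notin A)].

(** The variables killing [x_i] modulo the edge ideal and [x_l], [l < i]; over
    the exterior algebra [x_i] itself is one of them. *)
Definition x_link (e : bool) (i : nat) : {set 'I_(m + lam 1)} :=
  [set u | match split u with
           | inl l => l < i + e
           | inr j => j < lam i.+1
           end]%N.

Lemma in_x_link_x e i l : (x_ l \in x_link e i) = (l < i + e)%N.
Proof. by rewrite inE (unsplitK (inl l)). Qed.

Lemma in_x_link_y e i j : (y_ j \in x_link e i) = (j < lam i.+1)%N.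
Proof. by rewrite inE (unsplitK (inr j)). Qed.

Lemma x_avoidingS (i : 'I_m) A : x_avoiding i.+1 A = deletion (x_ i) (x_avoiding i) A.
Proof.
rewrite /x_avoiding /deletion andbCA; congr (_ && _).
apply/forall_inP/andP => [av|[iA /forall_inP av] l].
  split; first exact: av.
  by apply/forall_inP => l li; apply: av; rewrite ltnS ltnW.
by rewrite ltnS leq_eqVlt => /predU1P[/val_inj->//|]; apply: av.
Qed.

Lemma down_closed_x_avoiding i : down_closed (x_avoiding i).
Proof.
move=> A B sAB /andP[indB /forall_inP av]; apply/andP; split.
  exact: down_closed_independent indB.
by apply/forall_inP => l /av; apply: contra; apply: (subsetP sAB).
Qed.

Lemma link_x_avoiding e (i : 'I_m) :
  link e (x_ i) (x_avoiding i) =1 avoiding (x_link e i).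
Proof.
move=> A; have xinj l l' : (x_ l == x_ l') = (l == l').
  by apply/eqP/eqP => [/lshift_inj|->].
have yx j l : (y_ j == x_ l) = false by rewrite eq_sym eq_lrshift.
apply/and3P/idP => [[eA indA /forall_inP av]|avA].
  rewrite /avoiding disjoint_subset; apply/subsetP.
  apply: ferrers_vertex_ind => [l lA|j jA]; rewrite inE /= ?in_x_link_x ?in_x_link_y.
    rewrite -leqNgt leqNgt; apply/negP => l_lt.
    have [li|il] := ltnP l i; first by have := av l li; rewrite !inE lA orbT.
    have ee : e by move: l_lt; case: (e) => //; rewrite addn0 ltnNge il.
    have eil : l = i.
      by apply/val_inj/eqP; move: l_lt; rewrite ee addn1 ltnS eqn_leq il andbT.
    by move: eA; rewrite ee /= -eil lA.
  move/ferrers_independentP: indA => /(_ i j); rewrite !inE eqxx yx jA -leqNgt.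
  by apply.
have notA u : u \in A -> u \notin x_link e i by move=> uA; rewrite (disjointFr avA uA).
have xA l : x_ l \in A -> (i + e <= l)%N by move/notA; rewrite in_x_link_x -leqNgt.
have yA j : y_ j \in A -> (lam i.+1 <= j)%N by move/notA; rewrite in_x_link_y -leqNgt.
split.
- by apply/implyP => ee; apply/negP => /xA; rewrite ee addn1 ltnn.
- apply/ferrers_independentP => l j; rewrite !inE yx xinj /= => /orP[/eqP->|lA] jA.
    exact: yA.
  apply: leq_trans (yA j jA); apply: lam_leq => //; rewrite ltnS.
  by apply: leq_trans (xA l lA); rewrite leq_addr.
- apply/forall_inP => l li; rewrite !inE xinj negb_or; apply/andP; split.
    by apply: contraTneq li => ->; rewrite ltnn.
  by apply: contraL li => /xA il; rewrite -leqNgt (leq_trans _ il) ?leq_addr.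
Qed.

Lemma x_avoiding_all A :
  x_avoiding m A = avoiding [set u | if split u is inl _ then true else false] A.
Proof.
apply/andP/idP => [[_ /forall_inP av]|avA].
  rewrite /avoiding disjoint_subset; apply/subsetP.
  apply: ferrers_vertex_ind => [l lA|j _]; last by rewrite !inE (unsplitK (inr j)).
  by have := av l (ltn_ord l); rewrite lA.
have xA l : x_ l \notin A.
  by apply/negP => lA; have := disjointFr avA lA; rewrite inE (unsplitK (inl l)).
by split; [apply/ferrers_independentP => i j; rewrite (negPf (xA i))|apply/forall_inP].
Qed.

(** The shift by [e] keeps the two sides aligned: [x_(t + e)] and
    [y_(lam (t + 1) - 1)] lie in [x_link e i] for [t < i] and for [t >= i]
    respectively. *)
Lemma crossing_pairs (e : bool) : exists ps : seq ('I_(m + lam 1) * 'I_(m + lam 1)),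
  [/\ size ps = (m - e)%N, uniq (unzip1 ps ++ unzip2 ps) &
   forall p, p \in ps -> exists t (a : 'I_m) (b : 'I_(lam 1)),
     [/\ p = (x_ a, y_ b), a = (t + e)%N :> nat & b.+1 = lam t.+1]].
Proof.
have a_lt (t : 'I_(m - e)) : (t + e < m)%N by rewrite addnC -ltn_subRL.
have t_le (t : 'I_(m - e)) : (0 < t.+1 <= m)%N.
  by rewrite (leq_trans _ (a_lt t)) // ltnS leq_addr.
have b_lt (t : 'I_(m - e)) : ((lam t.+1).-1 < lam 1)%N.
  by rewrite prednK ?lam_leq ?lam_pos //; case/andP: (t_le t).
pose p t := (x_ (Ordinal (a_lt t)), y_ (Ordinal (b_lt t))).
have [r szr ur] : exists2 r : seq 'I_(m - e), size r = (m - e)%N & uniq r.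
  by exists (enum 'I_(m - e)); rewrite ?size_enum_ord ?enum_uniq.
exists [seq p t | t <- r]; split.
- by rewrite size_map.
- rewrite /unzip1 /unzip2 -!map_comp cat_uniq !map_inj_uniq ?ur ?andbT //=.
  + apply/hasPn => _ /mapP[t _ ->]; apply/negP => /mapP[t' _ /eqP].
    by rewrite eq_sym eq_lrshift.
  + move=> t t' /rshift_inj[/(congr1 S)]; rewrite !prednK ?lam_pos // => elam.
    apply/val_inj => /=; case: (ltngtP t t') => // tt'.
      by have := @lam_ltn t.+1 t'.+1 isT tt' (proj2 (andP (t_le t'))); rewrite elam ltnn.
    by have := @lam_ltn t'.+1 t.+1 isT tt' (proj2 (andP (t_le t))); rewrite elam ltnn.
  + by move=> t t' /lshift_inj[/addIn/val_inj].
move=> _ /mapP[t _ ->]; exists t, (Ordinal (a_lt t)), (Ordinal (b_lt t)).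
by split=> //=; rewrite prednK ?lam_pos.
Qed.

Lemma ferrers_regular_seq (e : bool) (R : nzRingType) (X : 'I_(m + lam 1) -> R)
    (N : pred {set 'I_(m + lam 1)} -> R^o -> Prop) : monomial_model e X N ->
  exists ps, size ps = (m - e)%N /\
    regular_seq_on e (@whole R R^o) (N (independent G)) (differences X ps).
Proof.
move=> monoN; have [ps [sz ups psE]] := crossing_pairs e.
exists ps; split=> //.
have ext D D' : down_closed D -> D =1 D' ->
    regular_seq_on e (@whole R R^o) (N D') (differences X ps) ->
    regular_seq_on e (@whole R R^o) (N D) (differences X ps).
  move=> dD DD'; apply: eq_regular_seq => //.
  - apply: (mono_submodule monoN) => A B sAB; rewrite -!DD'; exact: dD.
  - exact: (mono_submodule monoN).
  - exact: (differences_normal monoN).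
  - by move=> y _; split; apply: (mono_sub monoN) => A; rewrite DD'.
(* Descending induction: [i = m] is the quotient by all the [x_l], and [i = 0] is
   the quotient by the edge ideal. *)
suff reg i : (i <= m)%N ->
    regular_seq_on e (@whole R R^o) (N (x_avoiding i)) (differences X ps).
  apply: (ext _ (x_avoiding 0)) (reg 0%N isT).
    exact: down_closed_independent.
  by move=> A; rewrite /x_avoiding; case: independent => //=; apply/esym/forallP.
move=> im; rewrite -(subKn im); elim: (m - i)%N (leq_subr i m) => [_|j IHj jm].
  rewrite subn0; apply: ext (x_avoiding_all) _; first exact: down_closed_x_avoiding.
  apply: (differences_regular monoN) => // p /psE[t [a [b [-> _ _]]]].
  by rewrite !inE (unsplitK (inl a)) (unsplitK (inr b)).
have i_lt : (m - j.+1 < m)%N by rewrite ltn_subrL.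
have mj : (m - j = (m - j.+1).+1)%N by rewrite subnSK.
have {IHj} := IHj (ltnW jm); rewrite mj.
move: (m - j.+1)%N i_lt => {jm mj}l l_lt IHl.
pose i' := Ordinal l_lt.
apply: (vertex_decomposition_regular monoN (@down_closed_x_avoiding l)
  (@link_x_avoiding e i')).
  apply: (differences_regular monoN) => // p /psE[t [a [b [-> ea eb]]]].
  rewrite in_x_link_x in_x_link_y /= ea ltn_add2r eb.
  have tm : (t < m)%N by rewrite (leq_ltn_trans _ (ltn_ord a)) // ea leq_addr.
  case: (ltnP t l) => tl.
    by rewrite leqNgt lam_ltn.
  by rewrite lam_leq.
apply: ext IHl; first by apply: down_closed_deletion; apply: down_closed_x_avoiding.
by move=> A; rewrite (x_avoidingS i').
Qed.

End FerrersGraph.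

(** * Exterior and polynomial monomial ideals *)

Section IdealSpan.
Variables (R : nzRingType) (X : R -> Prop).

Lemma ideal_span0 : ideal_span X 0.
Proof. by exists [::]; rewrite ?big_nil. Qed.

Lemma ideal_span_mul a x b : X x -> ideal_span X (a * x * b).
Proof.
move=> Xx; exists [:: (a, x, b)]; last by rewrite big_seq1.
by move=> p; rewrite inE => /eqP->.
Qed.

Lemma ideal_spanD x y : ideal_span X x -> ideal_span X y -> ideal_span X (x + y).
Proof.
move=> [s Xs ->] [s' Xs' ->]; exists (s ++ s'); last by rewrite big_cat.
by move=> p; rewrite mem_cat => /orP[/Xs | /Xs'].
Qed.

Lemma ideal_span_sum (I : Type) (r : seq I) (P : pred I) (F : I -> R) :
  (forall i, P i -> ideal_span X (F i)) -> ideal_span X (\sum_(i <- r | P i) F i).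
Proof. by move=> XF; elim/big_ind: _ => //; [exact: ideal_span0|exact: ideal_spanD]. Qed.

Lemma ideal_span_submodule : submodule (ideal_span X : R^o -> Prop).
Proof.
split; [exact: ideal_span0|exact: ideal_spanD|move=> r _ [s Xs ->]].
rewrite scaler_sumr big_seq; apply: ideal_span_sum => p ps.
by rewrite /GRing.scale /= !mulrA; apply: ideal_span_mul; apply: Xs.
Qed.

End IdealSpan.

Section ExteriorModel.
Variables (k : comNzRingType) (n : nat).
Implicit Types (f g r : exterior k n) (A B : {set 'I_n}) (D : pred {set 'I_n}).

Definition ext_vanish D : (exterior k n)^o -> Prop :=
  fun f => forall A, D A -> (f : exterior k n) A = 0.

Lemma ext_mulE f g A : (f * g) A =
  \sum_(B : {set 'I_n} | B \subset A) (-1) ^+ inversions B (A :\: B) * f B * g (A :\: B).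
Proof. exact: ffunE. Qed.

Lemma ext_var_mulE z f A : (ext_var k z * f) A =
  if z \in A then (-1) ^+ inversions [set z] (A :\ z) * f (A :\ z) else 0.
Proof.
rewrite ext_mulE; case: ifPn => zA.
  rewrite (bigD1 [set z]) ?sub1set //= big1 => [|B /andP[_ /negPf nB]].
    by rewrite !ffunE eqxx mulr1 addr0.
  by rewrite ffunE nB mulr0 mul0r.
rewrite big1 // => B sBA; rewrite ffunE.
have /negPf-> : B != [set z] by apply: contraNneq zA => eB; rewrite -sub1set -eB.
by rewrite mulr0 mul0r.
Qed.

Lemma mul_ext_varE z f A : (f * ext_var k z) A =
  if z \in A then (-1) ^+ inversions (A :\ z) [set z] * f (A :\ z) else 0.
Proof.
have setDz B : B \subset A -> (A :\: B == [set z]) = (z \in A) && (B == A :\ z).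
  move=> sBA; apply/eqP/andP => [eB|[zA /eqP->]].
    have : z \in A :\: B by rewrite eB set11.
    by rewrite inE => /andP[_ zA]; rewrite -eB setDDr setDv set0U (setIidPr sBA).
  by rewrite setDDr setDv set0U; apply/setIidPr; rewrite sub1set.
rewrite ext_mulE; case: ifPn => zA.
  rewrite (bigD1 (A :\ z)) ?subsetDl //= big1 => [|B /andP[sBA /negPf nB]].
    have /eqP-> : A :\: (A :\ z) == [set z] by rewrite setDz ?subsetDl // zA /=.
    by rewrite ffunE eqxx mulr1 addr0.
  by rewrite ffunE setDz // nB andbF mulr0.
by rewrite big1 // => B sBA; rewrite ffunE setDz // (negPf zA) mulr0.
Qed.

Lemma ext_expand f : f = \sum_A f A *: ext_basis k A.
Proof.
apply/ffunP => B; rewrite sum_ffunE (bigD1 B) //= big1 => [|A /negPf nA].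
  by rewrite !ffunE eqxx /GRing.scale /= mulr1 addr0.
by rewrite !ffunE eq_sym nA /GRing.scale /= mulr0.
Qed.

Lemma ext_basis_mul_var A i :
  ext_basis k A * ext_var k i = (-1) ^+ #|A| *: (ext_var k i * ext_basis k A).
Proof.
rewrite ext_basisE cardE; elim: (enum A) => [|j s IHs] /=.
  by rewrite big_nil expr0 scale1r mul1r mulr1.
rewrite big_cons -mulrA IHs -scalerAr mulrA ext_var_anticomm exprS mulN1r scaleNr.
by rewrite mulNr scalerN opprK mulrA.
Qed.

(** The sign [(-1)^|A|] does not depend on the variable, so it can be absorbed
    in the other factor. *)
Lemma ext_deg1_normal (l : exterior k n) : ext_deg1 l -> normal_elt l.
Proof.
case=> c -> r; exists (\sum_A r A *: ((-1) ^+ #|A| *: ext_basis k A)).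
rewrite {1}[r]ext_expand [LHS]mulr_sumr [RHS]mulr_suml.
apply: eq_bigr => i _; rewrite [LHS]mulr_suml [RHS]mulr_sumr; apply: eq_bigr => A _.
rewrite -!scalerAl -!scalerAr ext_basis_mul_var.
by rewrite [RHS]scalerA [c i * _]mulrC -scalerA.
Qed.

Lemma ext_deg1_var_sub (i j : 'I_n) : ext_deg1 (ext_var k i - ext_var k j).
Proof.
exists (fun t => (t == i)%:R - (t == j)%:R).
under eq_bigr => t _ do rewrite scalerBl.
rewrite sumrB; congr (_ - _).
  by rewrite (bigD1 i) //= eqxx scale1r big1 ?addr0 // => t /negPf->; rewrite scale0r.
by rewrite (bigD1 j) //= eqxx scale1r big1 ?addr0 // => t /negPf->; rewrite scale0r.
Qed.

Lemma ext_vanish_submodule D : down_closed D -> submodule (ext_vanish D).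
Proof.
move=> dD; split=> [A _|f g Nf Ng A DA|r f Nf A DA].
- by rewrite ffunE.
- by rewrite ffunE Nf // Ng // addr0.
- rewrite ext_mulE big1 // => B sBA; rewrite Nf ?mulr0 //.
  by apply: dD DA; apply: subsetDl.
Qed.

Lemma ext_vanish_mulr D f r : down_closed D -> ext_vanish D f -> ext_vanish D (f * r).
Proof.
move=> dD Nf A DA; rewrite ext_mulE big1 // => B sBA.
by rewrite Nf ?mulr0 ?mul0r //; apply: dD DA.
Qed.

Lemma sign_mul_eq0 b (a : k) : ((-1) ^+ b * a == 0) = (a == 0).
Proof.
apply/eqP/eqP => [e0|->]; last exact: mulr0.
by rewrite -[a]mul1r -(sqrr_sign k b) expr2 -mulrA e0 mulr0.
Qed.

Lemma ext_monomial_model : monomial_model true (@ext_var k n) ext_vanish.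
Proof.
have link z D f (s : {set 'I_n} -> nat) (g : exterior k n) :
    (forall A, g A = if z \in A then (-1) ^+ s A * f (A :\ z) else 0) ->
    ext_vanish D g <-> ext_vanish (link true z D) f.
  move=> gE; split=> [Ng A /andP[/= zA DA]|Nf A DA]; last first.
    rewrite gE; case: ifP => // zA; rewrite Nf ?mulr0 //.
    by apply/andP; rewrite /= setD11 setD1K.
  have := Ng _ DA; rewrite gE setU11 setU1K // => /eqP.
  by rewrite sign_mul_eq0 => /eqP.
have div z D f (s : {set 'I_n} -> nat) (g : exterior k n) :
    (forall A, g A = if z \in A then
       (-1) ^+ s A * ((-1) ^+ s (z |: (A :\ z)) * f (z |: (A :\ z))) else 0) ->
    ext_vanish (deletion z D) f -> ext_vanish D (f - g).
  move=> gE Nf A DA; rewrite !ffunE gE; case: ifP => zA.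
    by rewrite setD1K // mulrA -expr2 sqrr_sign mul1r subrr.
  by rewrite subr0 Nf // /deletion zA.
split.
- exact: ext_vanish_submodule.
- by move=> D D' y DD' Ny A /DD'; apply: Ny.
- by [].
- by move=> z D y; apply: link (ext_var_mulE z y).
- by move=> z D y; apply: link (mul_ext_varE z y).
- move=> z D y; pose s (A : {set 'I_n}) := inversions [set z] (A :\ z).
  exists [ffun B : {set 'I_n} => (-1) ^+ s (z |: B) * y (z |: B)].
  apply: (div z D y s) => // A; rewrite ext_var_mulE; case: ifP => // zA.
  by rewrite ffunE.
- move=> z D y; pose s (A : {set 'I_n}) := inversions (A :\ z) [set z].
  exists [ffun B : {set 'I_n} => (-1) ^+ s (z |: B) * y (z |: B)].
  apply: (div z D y s) => // A; rewrite mul_ext_varE; case: ifP => // zA.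
  by rewrite ffunE.
- by move=> i j; apply/ext_deg1_normal/ext_deg1_var_sub.
- move=> i j _; rewrite mulrBl !mulrBr !ext_varxx (ext_var_anticomm k j i).
  by rewrite subr0 sub0r opprK addNr.
Qed.

Lemma edge_ideal_E_vanish (G : sgraph n) f :
  edge_ideal_E G f <-> ext_vanish (independent G) f.
Proof.
have dG := @down_closed_independent n G.
have sN := ext_vanish_submodule dG; split=> [[s Xs ->]|Nf].
  apply: (submodule_sum sN) => p ps; have [a [b [ab ->]]] := Xs p ps.
  apply: ext_vanish_mulr => //; case: (sN) => _ _; apply => A indA.
  rewrite ext_var_mulE; case: ifP => // aA; rewrite ffunE.
  case: eqP => [eA|]; last by rewrite mulr0.
  have : b \in A :\ a by rewrite eA set11.
  rewrite inE => /andP[_ bA]; case/negP: (independentP _ _ indA a b aA bA).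
  exact: ab.
rewrite [f]ext_expand; apply: ideal_span_sum => A _.
have [indA|] := boolP (independent G A).
  by rewrite Nf // scale0r; apply: ideal_span0.
rewrite negb_forall_in => /exists_inP[a aA]; rewrite negb_forall_in.
case/exists_inP=> b bA; rewrite negbK => ab.
have nab : a != b by apply: contraTneq ab => ->; rewrite adj_irr.
have ebE z (B : {set 'I_n}) : z \in B ->
    ext_basis k B = (-1) ^+ inversions [set z] (B :\ z) *: (ext_var k z * ext_basis k (B :\ z)).
  move=> zB; rewrite ext_basisM ?disjoints1 ?setD11 // scalerA -expr2 sqrr_sign.
  by rewrite scale1r setD1K.
rewrite (ebE a A aA) (ebE b (A :\ a)) ?inE 1?eq_sym ?nab //.
rewrite -scalerAr mulrA !scalerA scalerAr -[ext_var k a * ext_var k b]mul1r.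
apply: ideal_span_mul; exists a, b; split=> //; exact: ab.
Qed.

End ExteriorModel.

Section PolynomialModel.
Variables (k : comNzRingType) (n : nat).
Implicit Types (f g r : {mpoly k[n]}) (A B : {set 'I_n}) (D : pred {set 'I_n}).

Definition mnm_support (u : 'X_{1..n}) : {set 'I_n} := [set i | u i != 0%N].

Definition poly_vanish D : {mpoly k[n]}^o -> Prop :=
  fun f => forall u, D (mnm_support u) -> (f : {mpoly k[n]})@_u = 0.

Lemma mnm_supportD u v : mnm_support (u + v) = mnm_support u :|: mnm_support v.
Proof. by apply/setP => i; rewrite !inE mnmDE addn_eq0 negb_and. Qed.

Lemma mnm_support1 i : mnm_support U_(i) = [set i].
Proof. by apply/setP => j; rewrite !inE mnm1E [j == i]eq_sym; case: (i == j). Qed.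

Lemma mnm_subUK i (u : 'X_{1..n}) : i \in mnm_support u -> (u - U_(i) + U_(i))%MM = u.
Proof.
rewrite inE => ui; apply: submK; apply/mnm_lepP => j; rewrite mnm1E.
by case: eqP => [<-|//]; rewrite lt0n.
Qed.

Lemma mcoeff_XiM i f u :
  ('X_i * f)@_u = if i \in mnm_support u then f@_(u - U_(i)) else 0.
Proof.
rewrite -commr_mpolyX; case: ifPn => iu.
  by rewrite -{1}(mnm_subUK iu) addmC mcoeffMX.
rewrite mcoeffM big1 // => -[v w] /= /eqP eu; rewrite mcoeffX.
have /negPf-> : U_(i)%MM != (w : 'X_{1..n}).
  apply: contraNneq iu => ew; have := mnm_supportD v w.
  by rewrite -eu -ew mnm_support1 => ->; rewrite inE set11 orbT.
by rewrite mulr0.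
Qed.

Lemma poly_vanish_submodule D : down_closed D -> submodule (poly_vanish D).
Proof.
move=> dD; split=> [u _|f g Nf Ng u Du|r f Nf u Du].
- exact: mcoeff0.
- by rewrite mcoeffD Nf // Ng // addr0.
- rewrite mcoeffM big1 // => -[v w] /= /eqP eu; rewrite Nf ?mulr0 //.
  by have := mnm_supportD v w; rewrite -eu => eS; apply: dD Du; rewrite eS subsetUr.
Qed.

Lemma poly_vanish_mono D D' f : (forall A, D' A -> D A) ->
  poly_vanish D f -> poly_vanish D' f.
Proof. by move=> DD' Nf u /DD'; apply: Nf. Qed.

Lemma poly_monomial_model : monomial_model false (fun i => 'X_i) poly_vanish.
Proof.
have link z D f : poly_vanish D ('X_z * f) <-> poly_vanish (link false z D) f.
  split=> [Nf u /andP[_ Du]|Nf u Du].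
    have := Nf (u + U_(z))%MM; rewrite mcoeff_XiM mnm_supportD mnm_support1.
    by rewrite setUC setU11 addmK; apply.
  rewrite mcoeff_XiM; case: ifP => // zu; apply: Nf; rewrite /link /=.
  by rewrite setUC -mnm_support1 -mnm_supportD mnm_subUK.
have div z D f : poly_vanish (deletion z D) f ->
    exists g, poly_vanish D (f - 'X_z * g).
  move=> Nf; exists (\sum_(u <- msupp f | z \in mnm_support u) f@_u *: 'X_[u - U_(z)]).
  rewrite {1}[f]mpolyE (bigID (fun u => z \in mnm_support u)) /= mulr_sumr.
  rewrite [X in _ - X](eq_bigr (fun u => f@_u *: 'X_[u])) => [|u zu]; last first.
    by rewrite -scalerAr -mpolyXD addmC mnm_subUK.
  rewrite addrC addrK => v Dv; rewrite raddf_sum big1 //= => u zu.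
  rewrite mcoeffZ mcoeffX; case: eqP => [euv|_]; last by rewrite mulr0.
  by rewrite Nf ?mul0r // /deletion zu euv.
split.
- exact: poly_vanish_submodule.
- by move=> D D' f; apply: poly_vanish_mono.
- by [].
- exact: link.
- by move=> z D f; rewrite mulrC; apply: link.
- exact: div.
- by move=> z D f /div[g Ng]; exists g; rewrite mulrC.
- by move=> i j r; exists r; rewrite mulrC.
- by [].
Qed.

Lemma edge_ideal_S_vanish (G : sgraph n) f :
  edge_ideal_S G f <-> poly_vanish (independent G) f.
Proof.
have dG := @down_closed_independent n G.
have sN := poly_vanish_submodule dG; split=> [[s Xs ->]|Nf].
  apply: (submodule_sum sN) => p ps; have [a [b [ab ->]]] := Xs p ps.
  rewrite mulrC mulrA; case: (sN) => _ _; apply => u indu.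
  rewrite mcoeff_XiM; case: ifP => // au; rewrite mcoeffX.
  case: eqP => // eu; have bu : b \in mnm_support u.
    by rewrite -(mnm_subUK au) -eu mnm_supportD mnm_support1 !inE eqxx.
  by case/negP: (independentP _ _ indu a b au bu); exact: ab.
rewrite [f]mpolyE; apply: ideal_span_sum => u _.
have [indu|] := boolP (independent G (mnm_support u)).
  by rewrite Nf // scale0r; apply: ideal_span0.
rewrite negb_forall_in => /exists_inP[a au]; rewrite negb_forall_in.
case/exists_inP=> b bu; rewrite negbK => ab.
have bu' : b \in mnm_support (u - U_(a))%MM.
  have nab : (a == b) = false by apply: contraTF ab => /eqP->; rewrite adj_irr.
  by move: bu; rewrite !inE mnmBE mnm1E nab subn0.
rewrite -(mnm_subUK au) -(mnm_subUK bu') !mpolyXD -mulrA ['X_b * _]mulrC scalerAl.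
rewrite -[X in ideal_span _ X]mulr1; apply: ideal_span_mul.
by exists a, b.
Qed.

End PolynomialModel.

(** * Upper bound over the polynomial ring: Koszul complexes *)

Lemma ext_deg1_sq0 (k : comNzRingType) n (l : exterior k n) :
  ext_deg1 l -> l * l = 0.
Proof.
case=> c ->; elim: (index_enum _) => [|j r IHr]; first by rewrite big_nil mulr0.
rewrite big_cons; set L := \sum_(i <- r) _ in IHr *.
have anti : ext_var k j * L = - (L * ext_var k j).
  rewrite mulr_sumr mulr_suml -sumrN; apply: eq_bigr => i _.
  by rewrite -scalerAr -scalerAl ext_var_anticomm scalerN.
rewrite mulrDl !mulrDr IHr addr0 -!scalerAl -!scalerAr ext_varxx !scaler0 add0r.
by rewrite anti scalerN addNr.
Qed.

Section Koszul.
Variables (S : comNzRingType) (n : nat) (x : 'I_n -> S).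
Local Notation K := (exterior S n).
Implicit Types (b c f u w : K) (A B : {set 'I_n}) (N : S^o -> Prop).

Definition koszul_elt : K := \sum_i x i *: ext_var S i.

Lemma koszul_eltM c A : (koszul_elt * c) A =
  \sum_(i in A) x i * ((-1) ^+ inversions [set i] (A :\ i) * c (A :\ i)).
Proof.
rewrite /koszul_elt mulr_suml sum_ffunE [RHS]big_mkcond; apply: eq_bigr => i _.
rewrite -scalerAl [LHS]ffunE ext_var_mulE; case: ifP => // _; exact: mulr0.
Qed.

Lemma koszul_elt_sq0 : koszul_elt * koszul_elt = 0.
Proof. by apply: ext_deg1_sq0; exists x. Qed.

Definition contraction (i : 'I_n) c : K :=
  [ffun A : {set 'I_n} => if i \in A then 0 else (-1) ^+ inversions [set i] A * c (i |: A)].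

Lemma contractionE i c A : contraction i c A =
  if i \in A then 0 else (-1) ^+ inversions [set i] A * c (i |: A).
Proof. exact: ffunE. Qed.

Lemma inversions11 (i j : 'I_n) : inversions [set i] [set j] = (j < i)%N.
Proof.
rewrite /inversions; case: (boolP (j < i)%N) => [ji|ij].
  by apply/eqP/cards1P; exists (i, j); apply/setP=> -[a b];
    rewrite !inE xpair_eqE /=; case: eqP => //= ->; case: eqP => //= ->.
apply: eq_card0 => -[a b]; rewrite !inE /=.
by apply/negbTE; apply: contra ij => /andP[/andP[/eqP-> /eqP->]].
Qed.

(** Contraction is an antiderivation. *)
Lemma contraction_ext_var i j f :
  contraction i (ext_var S j * f) + ext_var S j * contraction i f = f *+ (i == j).
Proof.
apply/ffunP => A; rewrite [LHS]ffunE ext_var_mulE !contractionE ext_var_mulE.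
have [<-|nij] := eqVneq i j.
  have [iA|iA] := boolP (i \in A).
    by rewrite !inE eqxx /= setD1K // add0r mulrA -expr2 sqrr_sign mul1r mulr1n.
  by rewrite setU11 setU1K // mulrA -expr2 sqrr_sign mul1r addr0 mulr1n.
rewrite mulr0n ffunE !inE [j == i]eq_sym (negPf nij) /=.
have [iA|iA] := boolP (i \in A); first by rewrite /= mulr0 if_same addr0.
have [jA|jA] := boolP (j \in A); last by rewrite mulr0 addr0.
rewrite /=.
have -> : (i |: A) :\ j = i |: A :\ j.
  apply/setP => a; rewrite !inE; case: (eqVneq a j) => [->|//].
  by rewrite eq_sym (negPf nij).
have invU (a b : 'I_n) B : b \notin B ->
    inversions [set a] (b |: B) = ((b < a)%N + inversions [set a] B)%N.
  move=> bB.
  by rewrite (@inversionsDr _ _ [set b]) ?subsetUl // inversions11 setU1K.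
rewrite -{1}(setD1K jA) !invU ?inE ?eqxx ?(negPf iA) ?andbF //.
rewrite !exprD; move: (inversions _ _) (inversions _ _) => p q.
rewrite -!mulrA; have -> : (i < j)%N = ~~ (j < i)%N.
  by rewrite -leqNgt [RHS]leq_eqVlt (negPf (nij : i != j :> nat)).
case: (j < i)%N; rewrite /= !expr1 !expr0; ring.
Qed.

(** The contraction by the [i]-th variable is a homotopy from multiplication
    by [x i] to zero. *)
Lemma koszul_homotopy i c :
  koszul_elt * contraction i c + contraction i (koszul_elt * c) = x i *: c.
Proof.
have contrS (a : S) f : contraction i (a *: f) = a *: contraction i f.
  apply/ffunP => A; rewrite [RHS]ffunE !contractionE [(a *: f) _]ffunE.
  by case: ifP => _; rewrite ?scaler0 // scalerAr.
have contr_sum (F : 'I_n -> K) :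
    contraction i (\sum_j F j) = \sum_j contraction i (F j).
  apply/ffunP => A; rewrite contractionE !sum_ffunE.
  under [RHS]eq_bigr => j _ do rewrite contractionE.
  by case: ifP => _; [rewrite big1|rewrite mulr_sumr].
rewrite /koszul_elt !mulr_suml contr_sum -big_split (bigD1 i) //= big1 => [|j nj].
  by rewrite addr0 -!scalerAl contrS -scalerDr addrC contraction_ext_var eqxx.
rewrite -!scalerAl contrS -scalerDr addrC contraction_ext_var eq_sym.
by rewrite (negPf nj) scaler0.
Qed.

(** A Koszul class of cohomological degree [d] on the quotient by [N] forces
    regular sequences to have length at most [d]: an element [t] of the ideal
    of the [x i] kills Koszul cohomology, so for a nonzero class [c] one has
    [t c = koszul_elt * b], and [b] is a nonzero class on the quotient by [t],
    of degree one less. *)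
Lemma koszul_regular_seq_size N (s : seq S) c d :
    submodule N ->
    (forall t, t \in s -> exists g : 'I_n -> S, t = \sum_i g i * x i) ->
    (forall i, (i < size s)%N -> nonzerodivisor (quot_seq N (take i s)) s`_i) ->
    (forall A, c A != 0 -> #|A| = d) ->
    (forall A, N ((koszul_elt * c) A)) ->
    ~ (exists b, forall A, N ((c - koszul_elt * b) A)) ->
  (size s <= d)%N.
Proof.
move=> sN s_in s_reg c_deg c_cycle c_nbd.
have normalS (t : S) : normal_elt t by move=> r; exists r; rewrite mulrC.
pose Q i := quot_seq N (take i s).
have sQ i : submodule (Q i) by apply: quot_seq_submodule.
have QM i f w : (forall A, Q i (w A)) -> forall A, Q i ((f * w) A).
  move=> Qw A; rewrite ext_mulE big_mkcond; apply: (submodule_sum (sQ i)) => B _.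
  by case: ifP => _; case: (sQ i) => // _ _; apply; apply: Qw.
suff step i : (i <= size s)%N -> exists c', [/\ forall A, c' A != 0 -> (#|A| + i)%N = d,
    forall A, Q i ((koszul_elt * c') A) &
    ~ (exists b, forall A, Q i ((c' - koszul_elt * b) A))].
  have [c' [deg _ nbd]] := step (size s) (leqnn _).
  have [A nA|c0] := pickP (fun A => c' A != 0).
    by rewrite -(deg A nA) leq_addl.
  case: nbd; exists 0 => A; rewrite mulr0 subr0.
  by move/negbFE/eqP: (c0 A) => ->; case: (sQ (size s)).
elim: i => [_|i IHi i_lt].
  exists c; split=> [A /c_deg|A|[b cb]]; first by rewrite addn0.
    by rewrite /Q take0; apply/quot_seq_nil.
  by apply: c_nbd; exists b => A; have := cb A; rewrite /Q take0 => /(quot_seq_nil _ sN).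
have {IHi} [c' [deg cycle nbd]] := IHi (ltnW i_lt).
set t := s`_i; have [g t_eq] := s_in t (mem_nth _ i_lt).
(* The homotopy formula applied to [t = \sum_j g j * x j]. *)
pose b := \sum_j g j *: contraction j c'.
have tc : t *: c' = koszul_elt * b + \sum_j g j *: contraction j (koszul_elt * c').
  rewrite t_eq scaler_suml mulr_sumr -big_split; apply: eq_bigr => j _ /=.
  by rewrite -scalerA -koszul_homotopy scalerDr scalerAr.
have Qrest A : Q i ((\sum_j g j *: contraction j (koszul_elt * c')) A).
  rewrite sum_ffunE; apply: (submodule_sum (sQ i)) => j _.
  rewrite [X in Q i X]ffunE contractionE; case: (sQ i) => Q0 _ QZ.
  by apply: (QZ); case: ifP => _ //; apply: QZ.
have QS y : Q i.+1 y <-> add_mul (@whole S S^o) (Q i) t y.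
  by rewrite /Q (take_nth 0) //; apply: quot_seq_rcons.
have [_ QD QZ] := sQ i.
exists b; split.
- move=> A; rewrite sum_ffunE => nz.
  have [j nzj|all0] := pickP (fun j => (g j *: contraction j c') A != 0); last first.
    by case/eqP: nz; apply: big1 => j _; apply/eqP/negbFE/all0.
  move: nzj; rewrite ffunE contractionE; case: ifPn => jA; first by rewrite scaler0 eqxx.
  move=> nzj; rewrite -(deg (j |: A)); first by rewrite cardsU1 jA addnS.
  by apply: contraNneq nzj => ->; rewrite mulr0 scaler0.
- move=> A; rewrite -[_ * b](addrK (\sum_j g j *: contraction j (koszul_elt * c'))) -tc.
  rewrite ffunE [(- _ : K) A]ffunE; apply: submoduleB => //.
    by apply/QS; rewrite ffunE; apply: add_mul_scale.
  by apply/QS; apply: add_mul_sub.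
move=> [b' bd]; have /fin_all_exists[u uP] A : exists a, Q i ((b - koszul_elt * b') A - t * a).
  by have /QS[a [_ Qa]] := bd A; exists a.
apply: nbd; exists (finfun u) => A; apply: (s_reg i i_lt).
have Qu B : Q i ((b - koszul_elt * b' - t *: (finfun u : K)) B).
  have := uP B; congr (Q i _); rewrite [RHS]ffunE; congr (_ + _).
  by rewrite !ffunE.
have := QM i koszul_elt _ Qu A; rewrite !mulrBr mulrA koszul_elt_sq0 mul0r subr0.
move=> /(QD _ _ (Qrest A)); congr (Q i _).
have KD (f f' : K) : f A + f' A = (f + f') A by rewrite [RHS]ffunE.
rewrite KD addrA [X in X - _]addrC -tc -scalerAr -scalerBr.
exact: ffunE.
Qed.

End Koszul.

Lemma irrelevant_idealP (k : comNzRingType) n (f : {mpoly k[n]}) :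
  irrelevant_ideal f -> exists g : 'I_n -> {mpoly k[n]}, f = \sum_i g i * 'X_i.
Proof.
move=> [s Xs ->]; elim: s Xs => [|p s IHs] Xs.
  by exists (fun=> 0); rewrite big_nil big1 // => i _; rewrite mul0r.
have [|g eg] := IHs; first by move=> q qs; apply: Xs; rewrite inE qs orbT.
have [i ei] := Xs p (mem_head _ _).
exists (fun j => (if j == i then p.1.1 * p.2 else 0) + g j).
rewrite big_cons eg (eq_bigr _ (fun j _ => mulrDl _ _ _)) big_split /=.
congr (_ + _); rewrite (bigD1 i) //= eqxx big1 ?addr0 => [|j /negPf->].
  by rewrite ei mulrAC.
by rewrite mul0r.
Qed.

Lemma independent1 n (G : sgraph n) a : independent G [set a].
Proof. by apply/independentP => u v; rewrite !inE => /eqP-> /eqP->; rewrite adj_irr. Qed.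

(** A linear monomial has degree 0 outside one variable, hence only one term of
    the Koszul differential contributes to its coefficient. *)
Lemma koszul_linear_coeff (k : comNzRingType) n
    (w : exterior {mpoly k[n]} n) (A : {set 'I_n}) u :
  u \in A ->
  ((koszul_elt (fun i => 'X_i : {mpoly k[n]}) * w) A)@_U_(u) =
    (-1) ^+ inversions [set u] (A :\ u) * (w (A :\ u))@_0%MM.
Proof.
move=> uA; rewrite koszul_eltM raddf_sum (bigD1 u) //= big1 => [|i /andP[_ iu]].
  rewrite mcoeff_XiM mnm_support1 set11 -[X in _@_(X - _)]add0m addmK addr0.
  rewrite -signr_odd -[in RHS]signr_odd.
  by case: odd; rewrite ?expr0 ?expr1 ?mul1r ?mulN1r ?mcoeffN.
by rewrite mcoeff_XiM mnm_support1 inE (negPf iu).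
Qed.

(** The class [X_a e_C], for [C] the set of the vertices that are not adjacent
    to [a], is a nonzero Koszul class: [X_a] is killed by the variables outside
    [C]. If the class were the boundary of [w], then the constant term of [w] at
    [C :\ a] would be both nonzero, by the coefficient of [X_a] at [C], and
    zero, by the coefficient of [X_b] at [b |: C :\ a]. *)
Lemma regular_seq_S_size (k : comNzRingType) n (G : sgraph n) a b s :
    adj G a b ->
    @regular_seq_S k n {mpoly k[n]}^o (edge_ideal_S G) s ->
  (size s <= #|[set u | ~~ adj G a u]|)%N.
Proof.
move=> ab [s_in s_reg _]; set C := [set u | _].
have aC : a \in C by rewrite inE adj_irr.
have bC : b \notin C by rewrite inE negbK.
pose x (i : 'I_n) : {mpoly k[n]} := 'X_i.
have sN : submodule (edge_ideal_S G : {mpoly k[n]}^o -> Prop).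
  exact: ideal_span_submodule.
have [N0 _ NZ] := sN.
pose c : exterior {mpoly k[n]} n := x a *: ext_basis _ C.
have cE A : c A = if A == C then x a else 0.
  by rewrite !ffunE; case: ifP => _; [apply: mulr1|apply: mulr0].
apply: (@koszul_regular_seq_size _ n x (edge_ideal_S G) s c) => //.
- by move=> t /s_in /irrelevant_idealP.
- by move=> A; rewrite cE; case: (A =P C) => [->//|_]; rewrite eqxx.
- move=> A; rewrite koszul_eltM big_mkcond; apply: (submodule_sum sN) => i _.
  case: ifP => // iA; rewrite cE; case: ifP => [/eqP eC|_]; last by rewrite !mulr0.
  have ai : adj G a i.
    by have := setD11 i A; rewrite eC inE => /negbFE.
  rewrite mulrC -mulrA; apply: NZ.
  by rewrite -[_ * _]mul1r -[1 * _]mulr1; apply: ideal_span_mul; exists a, i.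
move=> [w wN].
have wN1 (A : {set 'I_n}) u : u \in A -> (c A)@_U_(u) =
    (-1) ^+ inversions [set u] (A :\ u) * (w (A :\ u))@_0%MM.
  move=> uA; rewrite -koszul_linear_coeff //; apply/eqP; rewrite -subr_eq0; apply/eqP.
  have /edge_ideal_S_vanish/(_ U_(u)%MM) := wN A.
  rewrite mnm_support1 independent1 => /(_ isT); rewrite ffunE [(- _ : exterior _ _) A]ffunE.
  by rewrite mcoeffB.
have := wN1 C a aC; rewrite cE eqxx mcoeffXU eqxx => ewa.
have := wN1 (b |: C :\ a) b (setU11 _ _); rewrite setU1K; last first.
  by rewrite inE (negPf bC) andbF.
rewrite cE ifN => [|]; last by apply: contraNneq bC => <-; rewrite setU11.
rewrite mcoeff0 => /esym/eqP; rewrite sign_mul_eq0 => /eqP ew0.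
by move/eqP: ewa; rewrite ew0 mulr0 oner_eq0.
Qed.

(** * Upper bound over the exterior algebra *)

Section RegularLift.
Variables (R : nzRingType) (M : lmodType R).
Implicit Types (N : M -> Prop) (t l : R) (s : seq R).

(** The first element of a regular sequence can be skipped. Write [l y = 0] as
    [y = l z + t w] by regularity of [l] modulo [t]; then [t l w = 0], and the
    two hypotheses applied to [l w] and to [w] turn [t w] into a multiple of
    [l]. *)
Lemma regular_on_lift N t l :
    submodule N -> t * t = 0 -> l * l = 0 -> l * t = - (t * l) ->
    regular_on true (@whole _ M) N t ->
    regular_on true (@whole _ M) (add_mul (@whole _ M) N t) l ->
  regular_on true (@whole _ M) N l.
Proof.
move=> sN tt ll lt regt regl y _ Nly; have [_ ND NZ] := sN.
have [z [_ [w [_ Nyzw]]]] := regl y I (add_mul_sub t (submodule_whole M) Nly).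
have Ntlw : N (t *: (l *: w)).
  have := submoduleB sN (NZ l _ Nyzw) Nly.
  rewrite !scalerBr [l *: (l *: z)]scalerA ll scale0r subr0 addrAC subrr sub0r !scalerA lt scaleNr.
  by rewrite opprK.
have [w1 [_ Nlw]] := regt _ I Ntlw.
have [|z1 [_ [w2 [_ Nw]]]] := regl w I; first by exists w1.
exists (z - t *: z1); split=> //.
have := ND _ _ Nyzw (NZ t _ Nw).
rewrite !scalerBr [t *: (t *: _)]scalerA tt scale0r subr0 addrA addrNK /=.
by rewrite !scalerA lt scaleNr opprD !opprK addrA.
Qed.

Lemma eq_regular_on e N N' t : (forall x, N x <-> N' x) ->
  regular_on e (@whole _ M) N t -> regular_on e (@whole _ M) N' t.
Proof.
by move=> NN' reg y _ /NN' /(reg _ I)[z [_ /NN' Nz]]; exists z.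
Qed.

Lemma regular_on_lift_seq N s l :
    submodule N -> (forall t, t \in s -> normal_elt t) ->
    (forall t, t \in s -> t * t = 0 /\ l * t = - (t * l)) -> l * l = 0 ->
    (forall i, (i < size s)%N -> regular_on true (@whole _ M) (quot_seq N (take i s)) s`_i) ->
    forall i, (i <= size s)%N ->
    regular_on true (@whole _ M) (quot_seq N (take i s)) l ->
  regular_on true (@whole _ M) N l.
Proof.
move=> sN ns anti ll regs; elim=> [_|i IHi i_lt].
  by rewrite take0; apply: eq_regular_on => x; apply: quot_seq_nil.
move=> regl; apply: (IHi (ltnW i_lt)).
have t_in : s`_i \in s by apply: mem_nth.
have [tt lt] := anti _ t_in.
apply: (regular_on_lift _ tt ll lt (regs i i_lt)); first exact: quot_seq_submodule.
apply: eq_regular_on regl => x; rewrite (take_nth 0) //.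
exact/quot_seq_rcons/ns.
Qed.

End RegularLift.

Section ExteriorUpperBound.
Variables (k : fieldType) (n : nat) (G : sgraph n).
Implicit Types (l f z : exterior k n) (A : {set 'I_n}) (a b : 'I_n).

Lemma ext_deg1D l l' : ext_deg1 l -> ext_deg1 l' -> ext_deg1 (l + l').
Proof.
case=> c -> [c' ->]; exists (fun i => c i + c' i).
by rewrite -big_split; apply: eq_bigr => i _; rewrite scalerDl.
Qed.

Lemma ext_deg1Z (a : k) l : ext_deg1 l -> ext_deg1 (a *: l).
Proof.
case=> c ->; exists (fun i => a * c i).
by rewrite scaler_sumr; apply: eq_bigr => i _; rewrite scalerA.
Qed.

Lemma ext_deg1_sum (I : finType) (F : I -> exterior k n) :
  (forall i, ext_deg1 (F i)) -> ext_deg1 (\sum_i F i).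
Proof.
move=> dF; elim/big_ind: _ => //; last exact: ext_deg1D.
by exists (fun=> 0); rewrite big1 // => i _; rewrite scale0r.
Qed.

Lemma ext_deg1_anticomm l l' : ext_deg1 l -> ext_deg1 l' -> l * l' = - (l' * l).
Proof.
move=> dl dl'; apply/eqP; rewrite -addr_eq0; apply/eqP.
have := ext_deg1_sq0 (ext_deg1D dl dl').
by rewrite mulrDl !mulrDr (ext_deg1_sq0 dl) (ext_deg1_sq0 dl') add0r addr0.
Qed.

Lemma ext_deg1_coord l A : ext_deg1 l -> l A != 0 -> exists i, A = [set i].
Proof.
case=> c ->; rewrite sum_ffunE => nz.
have [i /eqP iA|none] := pickP (fun i => A == [set i]); first by exists i.
case/eqP: nz; apply: big1 => i _; rewrite !ffunE none; exact: mulr0.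
Qed.

Lemma ext_deg1_mul_coord1 l z i : ext_deg1 l -> (l * z) [set i] = l [set i] * z set0.
Proof.
move=> dl; rewrite ext_mulE (bigD1 [set i]) //= big1 => [|B /andP[sB nB]].
  by rewrite setDv inversions0r expr0 mul1r addr0.
have [->|/(ext_deg1_coord dl)[j eB]] := eqVneq (l B) 0; first by rewrite mulr0 mul0r.
by case/eqP: nB; move: sB; rewrite eB sub1set inE => /eqP->.
Qed.

Lemma ext_deg1_mul_var l a : ext_deg1 l ->
    (forall j, j != a -> ~~ adj G a j -> l [set j] = 0) ->
  ext_vanish (independent G) (l * ext_var k a).
Proof.
move=> dl l0 A indA; rewrite mul_ext_varE; case: ifP => // aA.
have [->|/(ext_deg1_coord dl)[j eA]] := eqVneq (l (A :\ a)) 0; first by rewrite mulr0.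
have : j \in A :\ a by rewrite eA set11.
rewrite !inE => /andP[ja jA]; rewrite eA l0 ?mulr0 //.
exact: (independentP _ _ indA).
Qed.

(** Let [l] be supported on [a] and its neighbours. Modulo the edge ideal [l]
    kills the variable of [a], which is a multiple of [l] only if [l] is a
    nonzero multiple of it. But then [l] kills the variable of the neighbour
    [b] as well, which is not a multiple of [l]. *)
Lemma star_form_not_regular l a b : adj G a b -> ext_deg1 l ->
    (forall j, j != a -> ~~ adj G a j -> l [set j] = 0) ->
  ~ regular_on true (@whole _ (exterior k n)^o) (edge_ideal_E G) l.
Proof.
move=> ab dl l0 reg.
have regE i : (forall j, j != i -> ~~ adj G i j -> l [set j] = 0) ->
    exists z, forall j, (j == i)%:R = l [set j] * z set0.
  move=> li0; have [|z [_ /edge_ideal_E_vanish Nz]] := reg (ext_var k i) I.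
    by apply/edge_ideal_E_vanish; apply: ext_deg1_mul_var.
  exists z => j; rewrite -ext_deg1_mul_coord1 //.
  have := Nz [set j] (independent1 _ _); rewrite ffunE [X in _ + X]ffunE => /eqP.
  rewrite subr_eq0 => /eqP ej; transitivity (ext_var k i [set j]); last exact: ej.
  by rewrite ffunE (inj_eq set1_inj).
have [z zP] := regE a l0.
have z0 : z set0 != 0 by apply: contra_eq_neq (zP a) => ->; rewrite eqxx mulr0 oner_eq0.
have lj j : j != a -> l [set j] = 0.
  move=> ja; apply/eqP; have /eqP := zP j.
  by rewrite (negPf ja) eq_sym mulf_eq0 (negPf z0) orbF.
have ba : b != a by apply: contraTneq ab => ->; rewrite adj_irr.
have [|z' z'P] := regE b.
  by move=> j _ nbj; apply: lj; apply: contraNneq nbj => ->; rewrite adj_sym.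
by have /eqP := z'P b; rewrite lj // mul0r eqxx oner_eq0.
Qed.

(** The form [l] is a nontrivial combination of the first [#|C|] elements whose
    [#|C| - 1] coordinates at the vertices of [C] other than [a] vanish. It is
    regular because, modulo the elements before the last one that occurs in it,
    it is a nonzero multiple of that last one. *)
Lemma regular_seq_E_size a b s :
    adj G a b ->
    @regular_seq_E k n (exterior k n)^o (edge_ideal_E G) s ->
  (size s < #|[set u | ~~ adj G a u]|)%N.
Proof.
move=> ab [s_deg s_reg]; set C := [set u | _].
have aC : a \in C by rewrite inE adj_irr.
rewrite (cardsD1 a C) aC ltnS leqNgt; apply/negP; set r := #|_| => r_lt.
pose A : 'M[k]_(r.+1, r) := \matrix_(i, j) (s`_i : exterior k n) [set enum_val j].
have [u u_neq0 uA0] : exists2 u : 'rV[k]_r.+1, u != 0 & u *m A = 0.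
  exists (nz_row (kermx A)).
    rewrite nz_row_eq0 -mxrank_eq0 mxrank_ker subn_eq0 -ltnNge.
    by rewrite ltnS rank_leq_col.
  by apply/sub_kermxP; apply: nz_row_sub.
have [i0 ui0 i0_max] : exists2 i0, u 0 i0 != 0 & forall i, u 0 i != 0 -> (i <= i0)%N.
  have [i ui] : exists i, u 0 i != 0.
    apply/existsP; apply: contraNT u_neq0 => /existsPn u0.
    by apply/eqP/rowP => i; rewrite mxE; apply/eqP/negbNE/u0.
  by case: (@arg_maxnP _ i (fun i => u 0 i != 0) val ui) => i0 ui0 i0P; exists i0.
pose l : exterior k n := \sum_i u 0 i *: s`_i.
have s_in (i : 'I_r.+1) : s`_i \in s by apply: mem_nth; apply: leq_trans r_lt.
have dl : ext_deg1 l. by apply: ext_deg1_sum => i; apply/ext_deg1Z/s_deg/s_in.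
have sN : submodule (edge_ideal_E G : (exterior k n)^o -> Prop).
  exact: ideal_span_submodule.
have sq0 t : t \in s -> t * t = 0 by move=> /s_deg /ext_deg1_sq0.
apply: (@star_form_not_regular l a b) => //.
  move=> j ja naj; have jD : j \in C :\ a by rewrite !inE ja.
  have := congr1 (fun v : 'rV_r => v 0 (enum_rank_in jD j)) uA0; rewrite !mxE => e0.
  rewrite sum_ffunE -[RHS]e0; apply: eq_bigr => i _; rewrite mxE enum_rankK_in //.
  exact: ffunE.
apply: (@regular_on_lift_seq _ _ _ s l _ _ _ _ _ i0) => //.
- by move=> t /s_deg; apply: ext_deg1_normal.
- move=> t ts; split; first exact: sq0.
  by apply: ext_deg1_anticomm => //; apply: s_deg.
- exact: ext_deg1_sq0.
- move=> i i_lt y _ /(s_reg i i_lt)[z Nz]; exists z; split=> //.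
- by apply/ltnW; apply: leq_trans r_lt; apply: ltn_ord.
pose Q := quot_seq (edge_ideal_E G : (exterior k n)^o -> Prop) (take i0 s).
have sQ : submodule Q by apply: quot_seq_submodule.
have Qdiff (y : (exterior k n)^o) : Q (l *: y - (u 0 i0 *: s`_i0) *: y).
  rewrite -scalerBl /l (bigD1 i0) //= addrAC subrr add0r scaler_suml.
  rewrite big_mkcond; apply: (submodule_sum sQ) => i _.
  case: ifPn => ni; last by case: sQ.
  have [->|ui] := eqVneq (u 0 i) 0; first by rewrite !scale0r; case: sQ.
  have i_lt : (i < i0)%N by rewrite ltn_neqAle ni i0_max.
  rewrite -[u 0 i *: _]mulr_algl -scalerA; case: sQ => _ _; apply; apply: quot_seq_scale.
  by rewrite -(nth_take 0 i_lt) mem_nth // size_takel // ltnW // (leq_trans _ r_lt).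
have i0_lt : (i0 < size s)%N by apply: leq_trans r_lt.
pose v : exterior k n := (u 0 i0)^-1%:A.
have usE (y : exterior k n) : (u 0 i0 *: s`_i0) * (v * y) = s`_i0 * y.
  by rewrite mulr_algl -scalerAl -scalerAr scalerA divff // scale1r.
move=> y _ Qly; have Qsy : Q (s`_i0 *: y).
  have Qly' : Q (l *: (v *: y)).
    rewrite [X in Q X](_ : _ = v *: (l *: y)); first by case: sQ => _ _; apply.
    by rewrite /GRing.scale /= !mulr_algl scalerAr.
  have := submoduleB sQ Qly' (Qdiff (v *: y)).
  by rewrite subKr; congr Q; apply: usE.
have [z Qz] := (s_reg i0 i0_lt y).1 Qsy.
exists (v *: z); split=> //.
have := submoduleB sQ Qz (Qdiff (v *: z)).
congr Q; rewrite [(u 0 i0 *: s`_i0) *: (v *: z)](usE z) opprB addrA addrNK.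
by [].
Qed.

End ExteriorUpperBound.

(** * The depth formulas *)

Lemma min_upto_first m (F : nat -> int) :
  (forall j, (1 <= j <= m)%N -> F 1%N <= F j) -> min_upto m F = F 1%N.
Proof.
move=> F1; rewrite /min_upto big_nat; elim/big_rec: _ => // j x jm ->.
by apply/min_idPr/F1; rewrite -ltnS.
Qed.

Theorem proposition4p3 (k : closedFieldType) (char0 : [pchar k] =i pred0)
    (m : nat) (lam : nat -> nat) (m_gt0 : (0 < m)%N)
    (lam_decr : forall i : nat, (1 <= i < m)%N -> (lam i.+1 < lam i)%N)
    (lam_gt0 : (0 < lam m)%N) :
  graph_depth_S k (ferrers_graph m lam)
    (m%:Z + min_upto m (fun j => (lam 1%N)%:Z - (lam j)%:Z - j%:Z + 1)) /\
  graph_depth_E k (ferrers_graph m lam)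
    (m%:Z + min_upto m (fun j => (lam 1%N)%:Z - (lam j)%:Z - j%:Z)).
Proof.
have lam_le j : (1 <= j <= m)%N -> (lam j)%:Z + j%:Z <= (lam 1%N)%:Z + 1.
  by move=> jm; rewrite -!PoszD lez_nat; apply: lam_add_leq jm.
have dS : m%:Z + min_upto m (fun j => (lam 1%N)%:Z - (lam j)%:Z - j%:Z + 1) = m%:Z.
  by rewrite min_upto_first => [|j /lam_le]; lia.
have dE : m%:Z + min_upto m (fun j => (lam 1%N)%:Z - (lam j)%:Z - j%:Z) = (m - 1)%N%:Z.
  by rewrite min_upto_first => [|j /lam_le]; lia.
rewrite dS dE; set G := ferrers_graph m lam.
have lam1_gt0 : (0 < lam 1)%N by apply: (lam_pos lam_decr lam_gt0); rewrite /= m_gt0.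
pose x1 := @lshift m (lam 1) (Ordinal m_gt0).
pose y1 := @rshift m (lam 1) (Ordinal lam1_gt0).
have edge : adj G x1 y1 by rewrite ferrers_adj_xy.
have nonadj : #|[set u | ~~ adj G x1 u]| = m.
  rewrite -[RHS]card_ord -(card_imset _ (@lshift_inj m (lam 1))); apply: eq_card.
  apply: ferrers_vertex_ind => i; rewrite inE.
    by rewrite ferrers_adj_xx; apply/esym/imset_f.
  rewrite ferrers_adj_xy ltn_ord; apply/esym/negbTE/imsetP => -[l _ /eqP].
  by rewrite eq_sym eq_lrshift.
split.
  split; last first.
    by move=> s sreg; rewrite lez_nat; have := regular_seq_S_size edge sreg; rewrite nonadj.
  have model := poly_monomial_model k (m + lam 1).
  have [ps [sz reg]] := ferrers_regular_seq m_gt0 lam_decr lam_gt0 model.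
  exists (differences (fun i => 'X_i) ps); last by rewrite size_map sz subn0.
  have sN : submodule (edge_ideal_S G : {mpoly k[m + lam 1]}^o -> Prop).
    exact: ideal_span_submodule.
  have norm := differences_normal model.
  split.
  - move=> _ /mapP[[i j] _ ->] /=; exists [:: (1, 'X_i, 1); (-1, 'X_j, 1)].
      by move=> q; rewrite !inE => /orP[] /eqP->; eexists.
    by rewrite big_cons big_seq1 /= !mulr1 mul1r mulN1r.
  - have reg' : regular_seq_on false (@whole _ _) (edge_ideal_S G : {mpoly k[m + lam 1]}^o -> Prop)
        (differences (fun i => 'X_i) ps).
      apply: eq_regular_seq reg => //; last by move=> f _; apply: edge_ideal_S_vanish.
        by apply: (mono_submodule model); apply: down_closed_independent.
      exact: norm.
    move=> i i_lt y Qy.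
    have [z [_]] := regular_seq_quot_seq sN (norm ps) reg' i_lt I Qy.
    by rewrite scale0r subr0.
  move=> /(_ 1) Q1.
  have : (1 : {mpoly k[m + lam 1]})@_0%MM = 0; last by move/eqP; rewrite mcoeff1 eqxx oner_eq0.
  have M0 (f g : {mpoly k[m + lam 1]}) : (f * g)@_0%MM = f@_0%MM * g@_0%MM.
    exact: (rmorphM (mcoeff 0%MM)).
  pose N' (f : {mpoly k[m + lam 1]}^o) := (f : {mpoly k[m + lam 1]})@_0%MM = 0.
  apply: (quot_seq_min (N' := N')) Q1; rewrite /N'.
  - split=> [|f g|r f]; first exact: mcoeff0.
      by rewrite mcoeffD => -> ->; rewrite addr0.
    by move=> f0; apply: etrans (M0 r f) _; rewrite f0 mulr0.
  - move=> f /edge_ideal_S_vanish; apply; apply/independentP => u v.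
    by rewrite inE mnm0E.
  move=> _ g /mapP[p _ ->]; apply: etrans (M0 _ g) _.
  by rewrite mcoeffB !mcoeffX !mnm1_eq0 subrr mul0r.
split; last first.
  move=> s sreg; rewrite lez_nat subn1 -ltnS prednK //.
  by have := regular_seq_E_size edge sreg; rewrite nonadj.
have model := ext_monomial_model k (m + lam 1).
have [ps [sz reg]] := ferrers_regular_seq m_gt0 lam_decr lam_gt0 model.
exists (differences (@ext_var k _) ps); last by rewrite size_map sz.
have sN : submodule (edge_ideal_E G : (exterior k (m + lam 1))^o -> Prop).
  exact: ideal_span_submodule.
have norm := differences_normal model.
split; first by move=> _ /mapP[p _ ->]; apply: ext_deg1_var_sub.
have reg' : regular_seq_on true (@whole _ _)
    (edge_ideal_E G : (exterior k (m + lam 1))^o -> Prop)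
    (differences (@ext_var k _) ps).
  apply: eq_regular_seq reg => //; last by move=> f _; apply: edge_ideal_E_vanish.
    by apply: (mono_submodule model); apply: down_closed_independent.
  exact: norm.
move=> i i_lt y; split=> [Qy|[z Qz]].
  have [z [_ Qz]] := regular_seq_quot_seq sN (norm ps) reg' i_lt I Qy.
  by exists z.
set t := _`_i in Qz *; have t0 : t * t = 0.
  exact: (differences_ker_mult model (mem_nth 0 i_lt)).
have [_ _ /(_ t _ Qz)] := quot_seq_submodule (edge_ideal_E G : (exterior k (m + lam 1))^o -> Prop)
  (take i (differences (@ext_var k _) ps)).
by rewrite scalerBr scalerA t0 scale0r subr0.
Qed.
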